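(* Let $f:\mathbb{R}^d\to\mathbb{R}$ be convex, differentiable and $L$-smooth ($L>0$), minimized at $x_*\in\mathbb{R}^d$. Let $x_t,z_t$, $t\ge 0$, be the continuized process (defined in the context) with parameter functions $\eta_t,\eta_t',\gamma_t,\gamma_t'$ and arbitrary initial points $x_0,z_0\in\mathbb{R}^d$. \begin{enumerate} \item If $\eta_t=\frac{2}{t}$, $\eta_t'=0$, $\gamma_t=\frac1L$, $\gamma_t'=\frac{t}{2L}$, then for all $t>0$, $$\mathbb{E} f(x_t)-f(x_* )\le \frac{2L\|z_0-x_*\|^2}{t^2}.$$ \item If moreover $f$ is $\mu$-strongly convex with $\mu>0$, and $\eta_t=\eta_t'\equiv\sqrt{\mu/L}$, $\gamma_t\equiv\frac1L$, $\gamma_t'\equiv\frac{1}{\sqrt{\mu L}}$, then for all $t\ge0$, $$\mathbb{E} f(x_t)-f(x_* )\le\Big(f(x_0)-f(x_* )+\frac{\mu}{2}\|z_0-x_*\|^2\Big)\exp\Big(-\sqrt{\tfrac{\mu}{L}}\,t\Big).$$ \end{enumerate}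
   Context: $f$ is $L$-smooth if $f(y)\le f(x)+\langle\nabla f(x),y-x\rangle+\frac L2\|y-x\|^2$ for all $x,y$, and $\mu$-strongly convex if $f(y)\ge f(x)+\langle\nabla f(x),y-x\rangle+\frac\mu2\|y-x\|^2$ for all $x,y$. Continuized process: let $T_0=0<T_1<T_2<\dots$ be random times such that $T_1,T_2-T_1,T_3-T_2,\dots$ are i.i.d. exponential random variables with rate $1$ (equivalently, $N=\sum_{k\ge1}\delta_{T_k}$ is a homogeneous Poisson point process on $\mathbb{R}_{\ge0}$ with intensity Lebesgue measure). Given functions $\eta_t,\eta'_t,\gamma_t,\gamma'_t$ of $t\ge0$, the processes $t\mapsto x_t,z_t\in\mathbb{R}^d$ are càdlàg (right-continuous with left limits $x_{t-},z_{t-}$), start at $x_0,z_0$, satisfy between consecutive jump times the linear ODE $\frac{d x_t}{dt}=\eta_t(z_t-x_t)$, $\frac{dz_t}{dt}=\eta'_t(x_t-z_t)$, and at each time $T_k$ ($k\ge1$) take gradient steps $x_{T_k}=x_{T_k-}-\gamma_{T_k}\nabla f(x_{T_k-})$, $z_{T_k}=z_{T_k-}-\gamma'_{T_k}\nabla f(x_{T_k-})$. Compactly, $dx_t=\eta_t(z_t-x_t)dt-\gamma_t\nabla f(x_t)dN(t)$, $dz_t=\eta'_t(x_t-z_t)dt-\gamma'_t\nabla f(x_t)dN(t)$. Expectation is over the random times. *)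

(* Defs.v *)
From HB Require Import structures.
From mathcomp Require Import all_boot all_order all_algebra.
From mathcomp Require Import all_classical all_reals all_analysis.
From mathcomp Require Import exponential_distribution.
Set Implicit Arguments. Unset Strict Implicit. Unset Printing Implicit Defensive.
Import Order.TTheory GRing.Theory Num.Theory.
Import numFieldNormedType.Exports.
Local Open Scope classical_set_scope.
Local Open Scope ring_scope.

Definition dotv {R : realType} {d : nat} (u v : 'rV[R]_d) : R :=
  \sum_(i < d) u 0 i * v 0 i.
Definition sqnorm {R : realType} {d : nat} (v : 'rV[R]_d) : R := dotv v v.

Definition grad {R : realType} {d : nat} (f : 'rV[R]_d -> R) (x : 'rV[R]_d)
  : 'rV[R]_d := \row_(i < d) ('d f x (delta_mx 0 i : 'rV[R]_d)).

Definition convex_fun {R : realType} {d : nat} (f : 'rV[R]_d -> R) : Prop :=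
  forall (x y : 'rV[R]_d) (l : R), 0 <= l -> l <= 1 ->
    f (l *: x + (1 - l) *: y) <= l * f x + (1 - l) * f y.

Definition L_smooth {R : realType} {d : nat} (f : 'rV[R]_d -> R) (L : R) : Prop :=
  forall x y : 'rV[R]_d,
    f y <= f x + dotv (grad f x) (y - x) + L / 2 * sqnorm (y - x).

Definition strongly_convex {R : realType} {d : nat} (f : 'rV[R]_d -> R) (mu : R)
  : Prop :=
  forall x y : 'rV[R]_d,
    f x + dotv (grad f x) (y - x) + mu / 2 * sqnorm (y - x) <= f y.

Definition mutual_indep {dT} {T : measurableType dT} {R : realType}
  (P : probability T R) (tau : nat -> {RV P >-> R}) : Prop :=
  forall (s : seq nat) (B : nat -> set R), uniq s ->
    (forall i, measurable (B i)) ->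
    P [set w | forall i, i \in s -> B i (tau i w)] =
      (\prod_(i <- s) P (tau i @^-1` B i))%E.

Definition jump_time {dT} {T : measurableType dT} {R : realType}
  {P : probability T R} (tau : nat -> {RV P >-> R}) (k : nat) (w : T) : R :=
  \sum_(i < k) tau i w.

(* outcomes for which all interarrival times are > 0 and T_k -> +oo
   (an event of probability one) *)
Definition good_outcome {dT} {T : measurableType dT} {R : realType}
  {P : probability T R} (tau : nat -> {RV P >-> R}) (w : T) : Prop :=
  (forall k, 0 < tau k w) /\ (fun k => jump_time tau k w) @ \oo --> +oo.

Definition continuized_path {R : realType} {d : nat} (f : 'rV[R]_d -> R)
  (eta eta' gam gam' : R -> R) (Tk : nat -> R) (x z : R -> 'rV[R]_d) : Prop :=
  [/\ (forall k t, Tk k < t -> t < Tk k.+1 ->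
        is_derive t 1 x (eta t *: (z t - x t)) /\
        is_derive t 1 z (eta' t *: (x t - z t))),
      (forall t, 0 < t -> x r @[r --> t^'+] --> x t /\ z r @[r --> t^'+] --> z t) &
      (forall k, exists xm zm : 'rV[R]_d,
          [/\ x r @[r --> (Tk k.+1)^'-] --> xm,
              z r @[r --> (Tk k.+1)^'-] --> zm,
              x (Tk k.+1) = xm - gam (Tk k.+1) *: grad f xm &
              z (Tk k.+1) = zm - gam' (Tk k.+1) *: grad f xm])].

Arguments mutual_indep {dT T R} P tau.

(* Main.v *)
Require Import Defs.
From HB Require Import structures.
From mathcomp Require Import all_boot all_order all_algebra.
From mathcomp Require Import all_classical all_reals all_analysis.
From mathcomp Require Import measurable_realfun exponential_distribution.
From mathcomp Require Import ring lra.
Set Implicit Arguments. Unset Strict Implicit. Unset Printing Implicit Defensive.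
Import Order.TTheory GRing.Theory Num.Theory.
Import numFieldNormedType.Exports.
Local Open Scope classical_set_scope.
Local Open Scope ring_scope.

(* A Lyapunov function Phi(t, x, z) = A(t) (f x - f xs) + B(t) |z - xs|^2 is chosen
   so that its drift along the linear ODE plus its increment under a gradient step
   is nonpositive; this is where (strong) convexity and smoothness enter. Let
   (T_k, Y_k) be the k-th jump time and the state just after it. Conditionally on
   the past, one exponential duration gives
     E[Phi(T_(k+1), Y_(k+1)); T_(k+1) <= t] + E[Phi(t, X_t); T_k <= t < T_(k+1)]
       <= E[Phi(T_k, Y_k); T_k <= t],
   because u |-> exp(-u) Phi(T_k + u, flow) has derivative at most
   - exp(-u) Phi(T_k + u, gradient step of the flow). Summing over k, which
   almost surely exhausts the possible positions of t among the jump times,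
   yields E Phi(t, X_t) <= Phi(0, Y_0). *)

(** * Smooth convex functions *)

(** Write A and B for the weights of [f] and of the squared distance. They solve A' = A eta = 2 B
    gamma' and A / (2 L) = B gamma'^2. The first relation makes the inner products of the gradient
    with z - xs cancel between flow and jump; the second lets the decrease of [f] under a step 1 / L
    pay for the term B gamma'^2 |grad f|^2. A path is given only by its properties, outcome by
    outcome, and only f (x_t) is known to be measurable. The linear ODE is therefore solved
    explicitly, which makes the post-jump states measurable functions of the durations; the path is
    then identified with this construction on good outcomes. The rate 2 / t is singular at time 0,
    so the initial condition of the ODE enters as a right limit. Integrability of f (x_t) is a
    conclusion: the integrands are nonnegative, so Tonelli and monotonicity suffice until the bound
    is known. *)

Section dot_product.
Context {R : realType} {d : nat}.
Implicit Types u v w : 'rV[R]_d.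

Lemma dotvC u v : dotv u v = dotv v u.
Proof. by apply: eq_bigr => i _; rewrite mulrC. Qed.

Lemma dotvDl u v w : dotv (u + v) w = dotv u w + dotv v w.
Proof. by rewrite -big_split; apply: eq_bigr => i _; rewrite mxE mulrDl. Qed.

Lemma dotvDr u v w : dotv w (u + v) = dotv w u + dotv w v.
Proof. by rewrite dotvC dotvDl !(dotvC w). Qed.

Lemma dotvZl a u v : dotv (a *: u) v = a * dotv u v.
Proof. by rewrite /dotv mulr_sumr; apply: eq_bigr => i _; rewrite mxE mulrA. Qed.

Lemma dotvZr a u v : dotv u (a *: v) = a * dotv u v.
Proof. by rewrite dotvC dotvZl dotvC. Qed.

Lemma dotvNl u v : dotv (- u) v = - dotv u v.
Proof. by rewrite -scaleN1r dotvZl mulN1r. Qed.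

Lemma dotvNr u v : dotv u (- v) = - dotv u v.
Proof. by rewrite dotvC dotvNl dotvC. Qed.

Definition dotvE := (dotvDl, dotvDr, dotvNl, dotvNr, dotvZl, dotvZr).

Lemma sqnorm_ge0 u : 0 <= sqnorm u.
Proof. by apply: sumr_ge0 => i _; rewrite -expr2 sqr_ge0. Qed.

Lemma sqr_coord_le_sqnorm u i : u 0 i ^+ 2 <= sqnorm u.
Proof.
rewrite /sqnorm /dotv (bigD1 i)//= expr2 lerDl.
by apply: sumr_ge0 => j _; rewrite -expr2 sqr_ge0.
Qed.

Lemma sqnorm_le_normr u : sqnorm u <= d%:R * `|u| ^+ 2.
Proof.
rewrite /sqnorm /dotv (@le_trans _ _ (\sum_(i < d) `|u| ^+ 2))//.
  apply: ler_sum => i _; rewrite -expr2 -real_normK ?num_real// lerXn2r ?nnegrE//.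
  by rewrite [leRHS]/Num.Def.normr/= mx_normrE (le_bigmax _ _ (0, i)).
by rewrite sumr_const card_ord -[leLHS]mulr_natl.
Qed.

End dot_product.

Section smooth_convex.
Context {R : realType} {d : nat}.
Implicit Types (f : 'rV[R]_d -> R) (x y v : 'rV[R]_d).

Lemma diff_dotv f x v : differentiable f x -> 'd f x v = dotv (grad f x) v.
Proof.
move=> df; rewrite [in LHS](row_sum_delta v) linear_sum.
by apply: eq_bigr => i _; rewrite linearZ/= mulrC mxE.
Qed.

(** Convexity bounds each difference quotient from [x] towards [y], with step in ]0, 1], by f y - f
    x; the bound passes to the limit of small steps. *)
Lemma convex_grad_le f x y : convex_fun f -> differentiable f x ->
  f x + dotv (grad f x) (y - x) <= f y.
Proof.
move=> cf df; rewrite -diff_dotv// -deriveE// addrC -lerBrDr.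
have dd : derivable f x (y - x) by exact: diff_derivable.
have := cvg_dnbhs_at_right dd => /cvgr_to_le; apply.
near=> h.
have h0 : 0 < h by near: h; exact: nbhs_right_gt.
have h1 : h <= 1 by near: h; exact: nbhs_right_le.
rewrite /= -[_ *: _]/(_ * _) mulrC ler_pdivrMr// lerBlDr.
have -> : h *: (y - x) + x = h *: y + (1 - h) *: x.
  by rewrite scalerBr scalerBl scale1r addrAC -addrA.
by rewrite (le_trans (cf _ _ _ (ltW h0) h1))//; lra.
Unshelve. all: by end_near. Qed.

Lemma smooth_descent f L x : 0 < L -> L_smooth f L ->
  f (x - L^-1 *: grad f x) <= f x - (2 * L)^-1 * sqnorm (grad f x).
Proof.
move=> L0 /(_ x (x - L^-1 *: grad f x)) /le_trans; apply.
rewrite [_ - _ - x]addrAC subrr add0r /sqnorm !dotvE.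
rewrite -/(sqnorm _) !(mulrN, mulNr) opprK.
have -> : L / 2 * (L^-1 * (L^-1 * sqnorm (grad f x))) = (2 * L)^-1 * sqnorm (grad f x).
  by field; rewrite gt_eqF.
have -> : L^-1 * dotv (grad f x) (grad f x) = 2 * ((2 * L)^-1 * sqnorm (grad f x)).
  by rewrite /sqnorm; field; rewrite gt_eqF.
by lra.
Qed.

(* The convex function [w => f w - <grad f x, w>] is minimal at [x]; comparing
   with its value after a gradient step from [y] gives co-coercivity. *)
Lemma grad_cocoercive f L x y : 0 < L -> convex_fun f ->
  (forall x, differentiable f x) -> L_smooth f L ->
  sqnorm (grad f y - grad f x) <=
  2 * L * (f y - f x - dotv (grad f x) (y - x)).
Proof.
move=> L0 cf df sf; pose D := grad f y - grad f x; pose v := y - L^-1 *: D.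
have vy : v - y = - (L^-1 *: D) by rewrite /v addrAC subrr add0r.
have vx : v - x = y - x - L^-1 *: D by rewrite /v addrAC.
have := convex_grad_le v cf (df x); have := sf y v; rewrite vy vx -/D.
have : sqnorm D = dotv (grad f y) D - dotv (grad f x) D.
  by rewrite /sqnorm -dotvNl -dotvDl.
clear vy vx; move: (f v) => fv; clear v; clearbody D.
move: (grad f x) (grad f y) => gx gy h3.
rewrite /sqnorm !dotvE -/(sqnorm D) !(mulrN, mulNr) opprK => h1 h2.
rewrite mulrC -ler_pdivrMr ?mulr_gt0//.
have h4 : L / 2 * (L^-1 * (L^-1 * sqnorm D)) = sqnorm D / (2 * L).
  by field; rewrite gt_eqF.
have h5 : L^-1 * dotv gy D - L^-1 * dotv gx D = 2 * (sqnorm D / (2 * L)).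
  by rewrite -mulrBr -h3; field; rewrite gt_eqF.
by move: h1; rewrite h4; move: h2 h5; lra.
Qed.

Lemma grad_lipschitz f L x y : 0 < L -> convex_fun f ->
  (forall x, differentiable f x) -> L_smooth f L ->
  sqnorm (grad f y - grad f x) <= L ^+ 2 * sqnorm (y - x).
Proof.
move=> L0 cf df sf; apply: (le_trans (grad_cocoercive _ _ L0 cf df sf)).
rewrite -lter_pdivlMl ?mulr_gt0//.
have -> : (2 * L)^-1 * (L ^+ 2 * sqnorm (y - x)) = L / 2 * sqnorm (y - x).
  by field; rewrite gt_eqF.
by have := sf x y; lra.
Qed.

(** Only differentiability of [f] is assumed. Continuity of the gradient is needed for the
    fundamental theorem of calculus along the flow and for the measurability of gradient steps. *)
Lemma continuous_grad f L : 0 < L -> convex_fun f ->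
  (forall x, differentiable f x) -> L_smooth f L -> continuous (grad f).
Proof.
move=> L0 cf df sf x; apply/(@cvgrPdist_le _ _ _ (nbhs x) (nbhs_filter x)) => /= e e0.
(* Going from the Euclidean to the sup norm costs a factor [d]; the summand 1 makes k at least 1, so
   that k (e / k)^2 = e^2 / k is at most e^2. *)
pose k : R := 1 + d%:R * L ^+ 2.
have k0 : 0 < k by rewrite ltr_wpDr// mulr_ge0// sqr_ge0.
have ek0 : 0 < e / k by rewrite divr_gt0.
near=> y.
rewrite [leLHS]/Num.Def.normr/= mx_normrE (bigmax_le _ (ltW e0))//= => -[i j] _ /=.
rewrite ord1 -ler_sqr ?nnegrE ?(ltW e0)// real_normK ?num_real//.
apply: (le_trans (sqr_coord_le_sqnorm _ _)).
apply: (le_trans (grad_lipschitz _ _ L0 cf df sf)).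
have xy : `|x - y| <= e / k.
  by near: y; apply/nbhs_ballP; exists (e / k) => //= y; rewrite -ball_normE => /ltW.
apply: (@le_trans _ _ (k * `|x - y| ^+ 2)).
  rewrite mulrDl mul1r (le_trans (ler_wpM2l (sqr_ge0 L) (sqnorm_le_normr _)))//.
  by rewrite mulrCA mulrA lerDr sqr_ge0.
rewrite (@le_trans _ _ (k * (e / k) ^+ 2))//.
  by rewrite ler_pM2l// lerXn2r ?nnegrE// divr_ge0// ltW.
have -> : k * (e / k) ^+ 2 = e ^+ 2 / k by field; rewrite gt_eqF.
by rewrite ler_pdivrMr// ler_peMr ?sqr_ge0// lerDl mulr_ge0// sqr_ge0.
Unshelve. all: by end_near. Qed.

End smooth_convex.

(** * Measurability in coordinates *)

Section coordinatewise_measurable.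
Context {dT} {T : measurableType dT} {R : realType} {d : nat}.

(** Coordinates stand in for a sigma-algebra on row vectors. *)
Definition measurable_coords (v : T -> 'rV[R]_d) :=
  forall i, measurable_fun [set: T] (fun w => v w 0 i).

(** Rounding [v] down to the grid of mesh 1 / (n + 1) leaves countably many values, so [f] of the
    rounded vector is measurable; by continuity it converges pointwise to [f \o v]. *)
Lemma measurable_continuous_comp (f : 'rV[R]_d -> R) (v : T -> 'rV[R]_d) :
  continuous f -> measurable_coords v -> measurable_fun [set: T] (f \o v).
Proof.
move=> cf mv.
pose fl n (w : T) : {ffun 'I_d -> int} := [ffun i => Num.floor (n.+1%:R * v w 0 i)].
pose gr n (m : {ffun 'I_d -> int}) : 'rV[R]_d := \row_i ((m i)%:~R / n.+1%:R).
have mfl n m : measurable [set w | fl n w = m].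
  have -> : [set w | fl n w = m] =
      \bigcap_(i in [set: 'I_d]) [set w | (m i)%:~R <= n.+1%:R * v w 0 i < (m i)%:~R + 1].
    apply/seteqP; split => [w <- i _|w wm] /=.
      by rewrite ffunE -intrD1; exact: floor_itv.
    by apply/ffunP => i; rewrite ffunE; apply: floor_def; rewrite intrD; exact: wm.
  apply: fin_bigcap_measurable => // i _.
  have mi : measurable_fun [set: T] (fun w => n.+1%:R * v w 0 i).
    exact: measurable_funM.
  have := mi measurableT `[(m i)%:~R, (m i)%:~R + 1[%classic (measurable_itv _).
  by rewrite setTI; congr (measurable _); apply/seteqP; split => w /=; rewrite in_itv.
apply: (@measurable_fun_cvg _ _ _ _ (fun n w => f (gr n (fl n w)))).
  move=> n _ B mB; rewrite setTI.
  have -> : (fun w => f (gr n (fl n w))) @^-1` B =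
      \bigcup_m ([set w | fl n w = m] `&` [set w | B (f (gr n m))]).
    apply/seteqP; split => [w Bw|w [m _ [/= <-]]//].
    by exists (fl n w).
  apply: countable_bigcupT_measurable => // m; apply: measurableI => //.
  have [Bm|nBm] := pselect (B (f (gr n m))).
    by rewrite (_ : [set _ | _] = setT)//; apply/seteqP; split.
  by rewrite (_ : [set _ | _] = set0)//; apply/seteqP; split.
move=> w _ /=.
apply: (@cvg_comp _ _ _ (fun n => gr n (fl n w)) f _ _ _ _ (cf (v w))).
apply/cvgrPdist_le => /= e e0.
near=> n.
rewrite [leLHS]/Num.Def.normr/= mx_normrE (bigmax_le _ (ltW e0))//= => -[j i] _ /=.
rewrite ord1 !mxE ffunE.
have n0 : 0 < n.+1%:R :> R by [].
have en : n.+1%:R^-1 <= e.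
  by apply/ltW; near: n; exact: (near_infty_natSinv_lt (PosNum e0)).
rewrite (le_trans _ en)//.
have /andP[h1 h2] := floor_itv (n.+1%:R * v w 0 i).
rewrite -(ler_pM2l n0) mulfV ?gt_eqF// -[X in X * _]gtr0_norm// -normrM mulrBr.
rewrite mulrCA mulfV ?gt_eqF// mulr1 ger0_norm ?subr_ge0//.
by move: h2; rewrite intrD; lra.
Unshelve. all: by end_near. Qed.

End coordinatewise_measurable.

(** * Calculus along a moving point of a line *)

Section derivative_along_segment.
Context {R : realType} {d : nat}.
Implicit Types (f : 'rV[R]_d -> R) (p v : 'rV[R]_d) (a : R -> R) (t da : R).

Lemma is_derive_line f p v r : differentiable f (p + r *: v) ->
  is_derive r 1 (fun h => f (p + h *: v)) (dotv (grad f (p + r *: v)) v).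
Proof.
move=> df; rewrite -diff_dotv// -deriveE//.
have E : (fun h : R => h^-1 *: (f (p + (h *: 1 + r) *: v) - f (p + r *: v))) =
         (fun h => h^-1 *: (f (h *: v + (p + r *: v)) - f (p + r *: v))).
  by apply/funext => h; rewrite scalerDl -[h *: 1]/(h * 1) mulr1 addrCA.
have /= dd : derivable f (p + r *: v) v by exact: diff_derivable.
by split; rewrite /derivable/derive /comp /=; rewrite E.
Qed.

Lemma is_derive_comp_line f p v a t da :
  differentiable f (p + a t *: v) -> is_derive t 1 a da ->
  is_derive t 1 (fun u => f (p + a u *: v))
    (da * dotv (grad f (p + a t *: v)) v).
Proof.
move=> df ad; rewrite mulrC.
exact: (@is_derive1_comp _ (fun h => f (p + h *: v)) a t _ _ (is_derive_line df) ad).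
Qed.

Lemma is_derive_sqnorm_line p v a t da : is_derive t 1 a da ->
  is_derive t 1 (fun u => sqnorm (p + a u *: v))
    (2 * da * dotv v (p + a t *: v)).
Proof.
move=> ad.
have -> : (fun u => sqnorm (p + a u *: v)) =
  (fun u => sqnorm p + (2 * dotv p v * a u + sqnorm v * a u ^+ 2)).
  by apply/funext => u; rewrite /sqnorm !dotvE (dotvC v p); ring.
apply: is_derive_eq; rewrite !dotvE (dotvC v p) /GRing.scale/= /sqnorm.
by ring.
Qed.

End derivative_along_segment.

(** * Lyapunov functions of jump schemes *)

Lemma cvg_coord {R : realType} {d : nat} {T} {F : set_system T} {FF : Filter F}
  (u : T -> 'rV[R]_d) (l : 'rV[R]_d) i : u x @[x --> F] --> l -> u x 0 i @[x --> F] --> l 0 i.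
Proof.
move=> ul; apply: (@cvg_comp _ _ _ u (fun v : 'rV[R]_d => v 0 i) _ _ _ ul).
exact: coord_continuous.
Qed.

Lemma cvg_dotv {R : realType} {d : nat} {T} {F : set_system T} {FF : Filter F}
  (u v : T -> 'rV[R]_d) (lu lv : 'rV[R]_d) :
  u x @[x --> F] --> lu -> v x @[x --> F] --> lv ->
  dotv (u x) (v x) @[x --> F] --> dotv lu lv.
Proof.
move=> ul vl; rewrite /dotv; elim: (index_enum _) => [|i r IH].
  by rewrite big_nil; under eq_fun do rewrite big_nil; exact: cvg_cst.
rewrite big_cons; under eq_fun do rewrite big_cons.
by apply: cvgD IH; apply: cvgM; exact: cvg_coord.
Qed.

(* Between jumps, the linear ODE started at [(x, z)] at time [s] reaches
   [(x + mix_x s u (z - x), z + mix_z s u (x - z))] at time [u].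
   [drift_x] and [drift_z] stand for [wt_f * eta_x] and [wt_z * eta_z], which
   stay continuous at time [0] even when [eta_x] is singular there. *)
Record scheme (R : realType) := Scheme {
  eta_x : R -> R; eta_z : R -> R; step_z : R -> R;
  mix_x : R -> R -> R; mix_z : R -> R -> R;
  wt_f : R -> R; wt_z : R -> R; dwt_f : R -> R; dwt_z : R -> R;
  drift_x : R -> R; drift_z : R -> R }.

Section lyapunov.
Context {R : realType} {d : nat}.
Variables (f : 'rV[R]_d -> R) (xs : 'rV[R]_d) (L : R) (S : scheme R).
Implicit Types (y : 'rV[R]_d * 'rV[R]_d) (s u t r : R).

Definition lyap t y := wt_f S t * (f y.1 - f xs) + wt_z S t * sqnorm (y.2 - xs).

Definition flow s u y :=
  (y.1 + mix_x S s u *: (y.2 - y.1), y.2 + mix_z S s u *: (y.1 - y.2)).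

Definition gstep t y :=
  (y.1 - L^-1 *: grad f y.1, y.2 - step_z S t *: grad f y.1).

(** The time derivative of [lyap] plus its derivative along the vector field of the ODE, with the
    products of weights and rates replaced by [drift_x] and [drift_z] so that it is continuous up to
    time 0. *)
Definition generator t y :=
  dwt_f S t * (f y.1 - f xs) + drift_x S t * dotv (grad f y.1) (y.2 - y.1) +
  (dwt_z S t * sqnorm (y.2 - xs) +
   2 * drift_z S t * dotv (y.1 - y.2) (y.2 - xs)).

(** The factor 1 - mix_x - mix_z in the two equations is the ratio of the current gap z - x to the
    initial one. The second case of [adm_mix_x0] is for a rate singular at 0: there the explicit
    solution need not start at its initial point, but the objective has weight zero. [adm_generator]
    is the one inequality that each scheme has to earn. *)
Record admissible : Prop := Admissible {
  adm_L : 0 < L;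
  adm_convex : convex_fun f;
  adm_diff : forall x, differentiable f x;
  adm_smooth : L_smooth f L;
  adm_min : forall x, f xs <= f x;
  adm_wt_f : forall t, 0 <= t -> 0 <= wt_f S t;
  adm_wt_z : forall t, 0 <= t -> 0 <= wt_z S t;
  adm_dwt_f : forall t, is_derive t 1 (wt_f S) (dwt_f S t);
  adm_dwt_z : forall t, is_derive t 1 (wt_z S) (dwt_z S t);
  adm_cont : [/\ continuous (dwt_f S), continuous (dwt_z S),
    continuous (drift_x S), continuous (drift_z S) & continuous (step_z S)];
  adm_drift_x : forall t, 0 < t -> drift_x S t = wt_f S t * eta_x S t;
  adm_drift_z : forall t, 0 < t -> drift_z S t = wt_z S t * eta_z S t;
  adm_eta : forall t, 0 < t -> 0 <= eta_x S t /\ 0 <= eta_z S t;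
  adm_mix_x : forall s u, 0 <= s -> s < u ->
    is_derive u 1 (mix_x S s) (eta_x S u * (1 - mix_x S s u - mix_z S s u));
  adm_mix_z : forall s u, 0 <= s -> s < u ->
    is_derive u 1 (mix_z S s) (eta_z S u * (1 - mix_x S s u - mix_z S s u));
  adm_mix_cont : forall s u, 0 <= s -> s <= u ->
    {for u, continuous (mix_x S s)} /\ {for u, continuous (mix_z S s)};
  adm_mix_x0 : forall s, 0 <= s -> mix_x S s s = 0 \/ s = 0 /\ wt_f S s = 0;
  adm_mix_z0 : forall s, 0 <= s -> mix_z S s s = 0;
  adm_mix_meas : measurable_fun [set: R * R] (fun p => mix_x S p.1 p.2) /\
    measurable_fun [set: R * R] (fun p => mix_z S p.1 p.2);
  adm_generator : forall t y, 0 <= t ->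
    generator t y + (lyap t (gstep t y) - lyap t y) <= 0 }.

Hypothesis adm : admissible.

Lemma lyap_ge0 t y : 0 <= t -> 0 <= lyap t y.
Proof.
move=> t0; rewrite addr_ge0// mulr_ge0 ?subr_ge0 ?sqnorm_ge0//.
- exact: adm_wt_f.
- exact: adm_min.
- exact: adm_wt_z.
Qed.

Lemma lyap_flow_start s y : 0 <= s -> lyap s (flow s s y) = lyap s y.
Proof.
move=> s0; rewrite /lyap /flow /= adm_mix_z0// scale0r addr0.
by have [->|[_ ->]] := adm_mix_x0 adm s0; rewrite ?scale0r ?addr0// !mul0r.
Qed.

Lemma is_derive_lyap_flow s u y : 0 <= s -> s < u ->
  is_derive u 1 (fun v => lyap v (flow s v y)) (generator u (flow s u y)).
Proof.
move=> s0 su; have u0 : 0 < u by exact: le_lt_trans su.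
have dax := adm_mix_x adm s0 su; have daz := adm_mix_z adm s0 su.
have dfl := is_derive_comp_line (adm_diff adm (y.1 + mix_x S s u *: (y.2 - y.1))) dax.
have dsq := is_derive_sqnorm_line (y.2 - xs) (y.1 - y.2) daz.
have dA := adm_dwt_f adm u; have dB := adm_dwt_z adm u.
have -> : (fun v => lyap v (flow s v y)) =
    wt_f S * ((fun v => f (y.1 + mix_x S s v *: (y.2 - y.1))) - cst (f xs)) +
    wt_z S * (fun v => sqnorm (y.2 - xs + mix_z S s v *: (y.1 - y.2))).
  by apply/funext => v; rewrite /lyap /flow /= [_ - xs]addrAC.
apply: is_derive_eq; rewrite /generator adm_drift_x// adm_drift_z//.
(* The flow keeps z - x on a fixed line and scales it by 1 - a - b, the factor already present in
   the derivatives of [mix_x] and [mix_z]. *)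
set a := mix_x S s u; set b := mix_z S s u.
have -> : (flow s u y).2 - (flow s u y).1 = (1 - a - b) *: (y.2 - y.1).
  rewrite /flow/= -/a -/b -(opprB y.2 y.1) scalerN [_ - _ *: _ - _]addrAC opprD addrA.
  by rewrite !scalerBl scale1r.
have -> : (flow s u y).1 - (flow s u y).2 = (1 - a - b) *: (y.1 - y.2).
  rewrite /flow/= -/a -/b -(opprB y.1 y.2) scalerN opprD addrA [_ - _ - y.2]addrAC.
  by rewrite !scalerBl scale1r.
have -> : (flow s u y).2 - xs = y.2 - xs + b *: (y.1 - y.2) by rewrite /flow/= addrAC.
rewrite !dotvZl !dotvZr /flow/= -/a -/b.
set X := y.1 + _; set Z := y.2 - xs + _.
rewrite -[LHS]/(wt_f S u * (eta_x S u * (1 - a - b) * dotv (grad f X) (y.2 - y.1) - 0) +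
  (f X - f xs) * dwt_f S u +
  (wt_z S u * (2 * (eta_z S u * (1 - a - b)) * dotv (y.1 - y.2) Z) +
   sqnorm Z * dwt_z S u)).
by ring.
Qed.

End lyapunov.

(** * The drift inequality integrated over one duration *)

Section one_step.
Context {R : realType} {d : nat}.
Variables (f : 'rV[R]_d -> R) (xs : 'rV[R]_d) (L : R) (S : scheme R).
Hypothesis adm : admissible f xs L S.
Implicit Types (y : 'rV[R]_d * 'rV[R]_d) (s u t r : R).

Local Notation lyap := (lyap f xs S).
Local Notation flow := (flow S).
Local Notation gstep := (gstep f L S).
Local Notation generator := (generator f xs S).

Lemma continuous_wt : continuous (wt_f S) /\ continuous (wt_z S).
Proof.
split=> t; apply: differentiable_continuous; apply/derivable1_diffP.
- by case: (adm_dwt_f adm t).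
- by case: (adm_dwt_z adm t).
Qed.

Lemma continuous_objective : continuous f.
Proof. by move=> x; apply/differentiable_continuous/(adm_diff adm). Qed.

Lemma cvg_flow s u y : 0 <= s -> s <= u ->
  (flow s v y).1 @[v --> u] --> (flow s u y).1 /\
  (flow s v y).2 @[v --> u] --> (flow s u y).2.
Proof.
move=> s0 su; have [cx cz] := adm_mix_cont adm s0 su.
by split; rewrite /flow/=; apply: cvgD; do ?exact: cvg_cst; apply: cvgZr_tmp.
Qed.

Lemma cvg_lyap u (p q : R -> 'rV[R]_d) (p0 q0 : 'rV[R]_d) :
  p v @[v --> u] --> p0 -> q v @[v --> u] --> q0 ->
  lyap v (p v, q v) @[v --> u] --> lyap u (p0, q0).
Proof.
move=> cp cq; have [cA cB] := continuous_wt.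
apply: cvgD; apply: cvgM; do ?by [exact: cA|exact: cB].
  apply: cvgB; last exact: cvg_cst.
  exact: (@cvg_comp _ _ _ p f _ _ _ cp (@continuous_objective _)).
by apply: cvg_dotv; apply: cvgB => //; exact: cvg_cst.
Qed.

Lemma cvg_grad_flow s u y : 0 <= s -> s <= u ->
  grad f (flow s v y).1 @[v --> u] --> grad f (flow s u y).1.
Proof.
move=> s0 su; have [c1 c2] := cvg_flow y s0 su.
apply: (@cvg_comp _ _ _ (fun v => (flow s v y).1) (grad f) _ _ _ c1).
exact: (continuous_grad (adm_L adm) (adm_convex adm) (adm_diff adm) (adm_smooth adm)).
Qed.

Lemma cvg_lyap_flow s u y : 0 <= s -> s <= u ->
  lyap v (flow s v y) @[v --> u] --> lyap u (flow s u y).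
Proof. by move=> s0 su; have [c1 c2] := cvg_flow y s0 su; exact: (cvg_lyap c1 c2). Qed.

Lemma cvg_lyap_gstep s u y : 0 <= s -> s <= u ->
  lyap v (gstep v (flow s v y)) @[v --> u] --> lyap u (gstep u (flow s u y)).
Proof.
move=> s0 su; have [c1 c2] := cvg_flow y s0 su; have [_ _ _ _ cg] := adm_cont adm.
have cG := @cvg_grad_flow s u y s0 su.
have h1 : (flow s v y).1 - L^-1 *: grad f (flow s v y).1 @[v --> u] -->
    (flow s u y).1 - L^-1 *: grad f (flow s u y).1.
  exact: (cvgB c1 (cvgZ (cvg_cst L^-1) cG)).
have h2 : (flow s v y).2 - step_z S v *: grad f (flow s v y).1 @[v --> u] -->
    (flow s u y).2 - step_z S u *: grad f (flow s u y).1.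
  exact: (cvgB c2 (cvgZ (cg u) cG)).
exact: (cvg_lyap h1 h2).
Qed.

Lemma cvg_generator_flow s u y : 0 <= s -> s <= u ->
  generator v (flow s v y) @[v --> u] --> generator u (flow s u y).
Proof.
move=> s0 su; have [c1 c2] := cvg_flow y s0 su; have [cA cB cX cZ _] := adm_cont adm.
have h1 : f (flow s v y).1 - f xs @[v --> u] --> f (flow s u y).1 - f xs.
  apply: cvgB; last exact: cvg_cst.
  exact: (@cvg_comp _ _ _ (fun v => (flow s v y).1) f _ _ _ c1 (@continuous_objective _)).
have cg := @cvg_grad_flow s u y s0 su.
have c21 : (flow s v y).2 - (flow s v y).1 @[v --> u] -->
    (flow s u y).2 - (flow s u y).1 by exact: cvgB c2 c1.
have c12 : (flow s v y).1 - (flow s v y).2 @[v --> u] -->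
    (flow s u y).1 - (flow s u y).2 by exact: cvgB c1 c2.
have c2x : (flow s v y).2 - xs @[v --> u] --> (flow s u y).2 - xs by
  exact: cvgB c2 (cvg_cst xs).
have h2 := @cvg_dotv _ _ _ _ (nbhs_filter u) _ _ _ _ cg c21.
have h3 := @cvg_dotv _ _ _ _ (nbhs_filter u) _ _ _ _ c2x c2x.
have h4 := @cvg_dotv _ _ _ _ (nbhs_filter u) _ _ _ _ c12 c2x.
have h5 : 2 * drift_z S v @[v --> u] --> 2 * drift_z S u.
  by apply: cvgM; [exact: cvg_cst|exact: cZ].
rewrite /generator; apply: cvgD; apply: cvgD.
- exact: (cvgM (cA u) h1).
- exact: (cvgM (cX u) h2).
- exact: (cvgM (cB u) h3).
- exact: (cvgM h5 h4).
Qed.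

Lemma lyap_step s a y : 0 <= s -> 0 <= a ->
  (\int[lebesgue_measure]_(r in `[0%R, a])
     (expR (- r) * lyap (s + r) (gstep (s + r) (flow s (s + r) y)))%:E +
   (expR (- a) * lyap (s + a) (flow s (s + a) y))%:E <= (lyap s y)%:E)%E.
Proof.
move=> s0; rewrite le_eqVlt => /predU1P[<-|a0].
  rewrite set_itv1 integral_set1 add0e oppr0 expR0 mul1r addr0.
  by rewrite (lyap_flow_start adm).
have shift (g : R -> R) r : g v @[v --> s + r] --> g (s + r) ->
    g (s + v) @[v --> r] --> g (s + r).
  move=> cg; apply: (@cvg_comp _ _ _ (fun v => s + v) g _ _ _ _ cg).
  by apply: cvgD; [exact: cvg_cst|exact: cvg_id].
have cexp r : expR (- v) @[v --> r] --> expR (- r).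
  apply: continuous_comp; last exact: continuous_expR.
  exact: opp_continuous.
(* The sign makes the derivative [D] of [G] nonnegative, so that [h] and [D] can be compared by
   monotonicity of nonnegative integrals. *)
pose G r := - (expR (- r) * lyap (s + r) (flow s (s + r) y)).
pose h r := expR (- r) * lyap (s + r) (gstep (s + r) (flow s (s + r) y)).
pose D r := expR (- r) * (lyap (s + r) (flow s (s + r) y) -
                         generator (s + r) (flow s (s + r) y)).
have sr r : 0 <= r -> s <= s + r by rewrite lerDl.
have cG r : 0 <= r -> G v @[v --> r] --> G r.
  move=> r0; apply: cvgN; apply: (cvgM (cexp r)).
  exact: (shift (fun u => lyap u (flow s u y)) r (@cvg_lyap_flow s _ y s0 (sr _ r0))).
have ch r : 0 <= r -> h v @[v --> r] --> h r.
  move=> r0; apply: (cvgM (cexp r)).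
  exact: (shift (fun u => lyap u (gstep u (flow s u y))) r
    (@cvg_lyap_gstep s _ y s0 (sr _ r0))).
have cD r : 0 <= r -> D v @[v --> r] --> D r.
  move=> r0; apply: (cvgM (cexp r)); apply: cvgB.
    exact: (shift (fun u => lyap u (flow s u y)) r (@cvg_lyap_flow s _ y s0 (sr _ r0))).
  exact: (shift (fun u => generator u (flow s u y)) r
    (@cvg_generator_flow s _ y s0 (sr _ r0))).
have within (g : R -> R) : (forall r, 0 <= r -> g v @[v --> r] --> g r) ->
    {within `[0, a], continuous g}.
  move=> cg; apply: continuous_in_subspaceT => r.
  by rewrite inE/= in_itv/= => /andP[r0 _]; exact: cg.
have mE (g : R -> R) : (forall r, 0 <= r -> g v @[v --> r] --> g r) ->
    measurable_fun `[0, a] (fun r => (g r)%:E).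
  move=> cg; apply/measurable_EFinP.
  by apply: subspace_continuous_measurable_fun => //; exact: within.
(* The endpoint r = 0 is left out because the rates may be singular at s = 0; continuity suffices
   there. *)
have dG r : 0 < r -> is_derive r 1 G (D r).
  move=> r0; have ssr : s < s + r by rewrite ltrDl.
  have dl : is_derive r 1 (fun v => lyap (s + v) (flow s (s + v) y))
      (generator (s + r) (flow s (s + r) y)).
    have := is_derive_lyap_flow adm y s0 ssr => dl.
    have := @is_derive1_comp _ (fun v => lyap v (flow s v y)) (fun v => s + v) r
      (generator (s + r) (flow s (s + r) y)) 1 dl.
    rewrite mulr1; apply.
    have -> : (fun v => s + v) = cst s + id by [].
    by apply: is_derive_eq; rewrite add0r.
  have de : is_derive r 1 (fun v => expR (- v)) (- expR (- r)).
    have := @is_derive1_comp _ (@expR R) -%R r _ _ (is_derive_expR (- r))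
      (is_deriveNid r 1).
    by rewrite mulrN1.
  have -> : G = - ((fun v => expR (- v)) * (fun v => lyap (s + v) (flow s (s + v) y))) by [].
  apply: is_derive_eq; rewrite /D.
  rewrite -[X in - (X + _)]/(expR (- r) * _) -[X in - (_ + X)]/(lyap (s + r) (flow s (s + r) y) * - expR (- r)).
  by ring.
(* Without the factor exp(-r), the upper bound is [adm_generator] at the current point of the
   flow. *)
have hD r : 0 <= r -> 0 <= h r <= D r.
  move=> r0; have sr0 : 0 <= s + r by rewrite addr_ge0.
  rewrite mulr_ge0 ?expR_ge0 ?(lyap_ge0 adm)//= ler_pM2l ?expR_gt0//.
  by have := adm_generator adm (flow s (s + r) y) sr0; lra.
have FTC : (\int[lebesgue_measure]_(r in `[0%R, a]) (D r)%:E = (G a)%:E - (G 0)%:E)%E.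
  apply: continuous_FTC2 => //; first exact: within.
    split.
    - by move=> r; rewrite in_itv/= => /andP[r0 _]; case: (dG _ r0).
    - by apply: cvg_at_right_filter; exact: cG.
    - by apply: cvg_at_left_filter; apply: cG; exact: ltW.
  move=> r; rewrite in_itv/= => /andP[r0 _]; rewrite derive1E.
  by have [_ ->] := dG _ r0.
apply: (@le_trans _ _ (\int[lebesgue_measure]_(r in `[0%R, a]) (D r)%:E - (G a)%:E)%E).
  rewrite /G EFinN oppeK leeD2r//; apply: ge0_le_integral => //.
  - by move=> r; rewrite /= in_itv/= => /andP[r0 _]; rewrite lee_fin; case/andP: (hD _ r0).
  - exact: (mE h).
  - exact: (mE D).
  - move=> r; rewrite /= in_itv/= => /andP[r0 _]; rewrite lee_fin.
    by case/andP: (hD _ r0).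
rewrite FTC -!EFinN -!EFinD lee_fin addrAC subrr add0r /G opprK oppr0 expR0 mul1r addr0.
by rewrite (lyap_flow_start adm).
Qed.

End one_step.

(** * Exponential durations and independence *)

(** A density has the same integral as the Radon-Nikodym derivative over every measurable set, hence
    equals it almost everywhere, and the change of variables formula for the latter carries over. *)
Lemma ge0_integral_density {dT} {T : measurableType dT} {R : realType}
    (nu : {finite_measure set T -> \bar R})
    (mu : {sigma_finite_measure set T -> \bar R}) (p h : T -> \bar R) (D : set T) :
  measurable_fun [set: T] p ->
  (forall A, measurable A -> nu A = \int[mu]_(x in A) p x)%E ->
  measurable D -> measurable_fun D h -> (forall x, 0 <= h x)%E ->
  (\int[nu]_(x in D) h x = \int[mu]_(x in D) (h x * p x))%E.
Proof.
move=> mp nup mD mh h0.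
have numu : nu `<< mu.
  apply/null_content_dominatesP => A mA muA0; rewrite nup//.
  by apply: null_set_integral => //; exact: measurable_funTS.
rewrite -(Radon_Nikodym_SigmaFinite.change_of_variables numu h0 mD mh).
have iRN := Radon_Nikodym_SigmaFinite.f_integrable numu.
apply: ae_eq_integral => //.
- by apply: emeasurable_funM => //; apply/measurable_funTS/(measurable_int _ iRN).
- by apply: emeasurable_funM => //; exact: measurable_funTS.
- apply: ae_eqe_mul2l; apply: integral_ae_eq => //.
  + exact: integrableS iRN.
  + exact: measurable_funTS.
  + move=> A _ mA; rewrite -nup//.
    by rewrite -(Radon_Nikodym_SigmaFinite.f_integral numu).
Qed.

Section exponential_law.
Context {R : realType} (m : probability (measurableTypeR R) R).
Hypothesis mE : forall A : set R, measurable A -> m A = exponential_prob (1 : R) A.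

Let measurable_pdf : measurable_fun [set: R] (fun x => (exponential_pdf (1 : R) x)%:E).
Proof. by apply/measurable_EFinP; exact: measurable_exponential_pdf. Qed.

Lemma exponential_law_lt0 : m `]-oo, 0[%classic = 0%E.
Proof.
rewrite mE// /exponential_prob integral0_eq// => x /=; rewrite in_itv/= => x0.
by rewrite lt0_exponential_pdf.
Qed.

Lemma exponential_law_itvNyc a : 0 <= a ->
  m `]-oo, a]%classic = (1 - expR (- a))%:E.
Proof.
move=> a0; have -> : `]-oo, a]%classic = `]-oo, 0[%classic `|` `[0, a]%classic.
  by rewrite -itv_bndbnd_setU ?bnd_simp.
transitivity (m `]-oo, 0%R[%classic + m `[0%R, a]%classic)%E.
  apply: measureU => //.
  apply/seteqP; split => // x [] /=; rewrite !in_itv/= => xlt0 /andP[x0 _].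
  by rewrite ltNge x0 in xlt0.
rewrite exponential_law_lt0 add0e mE//.
move: a0; rewrite le_eqVlt => /predU1P[<-|a0].
  by rewrite /exponential_prob set_itv1 integral_set1 oppr0 expR0 subrr.
by rewrite exponential_prob_itv0c// mulN1r.
Qed.

Lemma exponential_law_itvoy a : 0 <= a ->
  m `]a, +oo[%classic = (expR (- a))%:E.
Proof.
move=> a0; rewrite -setCitvl probability_setC// exponential_law_itvNyc//.
by rewrite -EFinB opprB addrC subrK.
Qed.

(** Meant for [a] equal to the time left before t: every longer duration leaves t before the next
    jump, where the integrand no longer depends on the duration. The negative half-line is null, and
    the tail has mass exp(-a). *)
Lemma integral_exponential_law (h : R -> \bar R) (a c : R) :
  0 <= a -> 0 <= c -> measurable_fun [set: R] h -> (forall u, 0 <= h u)%E ->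
  (forall u, a < u -> h u = c%:E) ->
  (\int[m]_u h u =
   \int[lebesgue_measure]_(u in `[0%R, a]) (h u * (expR (- u))%:E) +
   (expR (- a) * c)%:E)%E.
Proof.
move=> a0 c0 mh h0 hc.
have mhD (D : set R) : measurable_fun D h by exact: measurable_funTS.
have -> : [set: R] = `]-oo, 0[%classic `|` `[0, a]%classic `|` `]a, +oo[%classic.
  rewrite -itv_bndbnd_setU ?bnd_simp// -itv_bndbnd_setU ?bnd_simp//.
  by rewrite set_itvNyy.
rewrite ge0_integral_setU//=; last 3 first.
- exact: measurableU.
- exact: mhD.
- apply/disj_setPS => x []; rewrite -itv_bndbnd_setU ?bnd_simp//= !in_itv/= andbT.
  by move=> xa ax; rewrite ltNge xa in ax.
rewrite ge0_integral_setU//=; last 2 first.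
- exact: mhD.
- apply/disj_setPS => x [] /=; rewrite !in_itv/= => x0 /andP[x0' _].
  by rewrite ltNge x0' in x0.
rewrite null_set_integral//; [|exact: mhD|exact: exponential_law_lt0].
rewrite add0e; congr (_ + _)%E; last first.
  rewrite (eq_integral (cst c%:E)); last first.
    by move=> x; rewrite inE/= in_itv/= andbT => /hc.
  rewrite integral_cst//.
by rewrite [X in (_ * X)%E](exponential_law_itvoy a0) -EFinM mulrC.
have md : measurable_fun [set: R] (fun x => (exponential_pdf (1 : R) x)%:E) by [].
have mp : (forall A, measurable A -> m A =
    \int[lebesgue_measure]_(x in A) (exponential_pdf (1 : R) x)%:E)%E.
  by move=> A mA; rewrite mE.
have E := @ge0_integral_density _ (measurableTypeR R) R m lebesgue_measure _ h `[0%R, a]%classic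
  md mp (measurable_itv _) (mhD _) h0.
apply: (etrans E); apply: eq_integral => x; rewrite inE/= in_itv/= => /andP[x0 _].
by rewrite exponential_pdfE// mul1r mulN1r.
Qed.

End exponential_law.

(** * Independence of the next duration from the past *)

Section independence.
Context {dT} {Omega : measurableType dT} {R : realType} (P : probability Omega R).
Variable tau : nat -> {RV P >-> R}.
Hypothesis tau_indep : mutual_indep P tau.

Definition cylinder k : set (set Omega) :=
  [set A | exists B : nat -> set R, (forall i, measurable (B i)) /\
    A = [set w | forall i, (i < k)%N -> B i (tau i w)]].

(** The outcomes again, with the coarser sigma-algebra of the first [k] durations. As a type of its
    own it can be a factor of a product space. *)
Definition past k : measurableType (sigma_display (cylinder k)) :=
  g_sigma_algebraType (cylinder k).

Lemma measurable_cylinder k : cylinder k `<=` measurable.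
Proof.
move=> _ [B [mB ->]].
have -> : [set w | forall i, (i < k)%N -> B i (tau i w)] =
    \bigcap_(i in `I_k) (tau i @^-1` B i) by [].
by apply: fin_bigcap_measurable => // i _; exact: measurable_funPTI.
Qed.

Lemma cylinderI k : setI_closed (cylinder k).
Proof.
move=> _ _ [B [mB ->]] [C [mC ->]]; exists (fun i => B i `&` C i); split.
  by move=> i; exact: measurableI.
apply/seteqP; split => [w [h1 h2] i ik|w h].
  by split; [exact: h1|exact: h2].
by split=> i ik; case: (h i ik).
Qed.

Lemma cylinderT k : cylinder k setT.
Proof. by exists (fun=> setT); split => //; apply/seteqP; split. Qed.

Lemma prob_cylinder k (B : nat -> set R) : (forall i, measurable (B i)) ->
  P [set w | forall i, (i < k)%N -> B i (tau i w)] =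
  (\prod_(i <- iota 0 k) P (tau i @^-1` B i))%E.
Proof.
move=> mB; rewrite -tau_indep ?iota_uniq//; congr (P _).
by apply/seteqP; split => w h i; [rewrite mem_iota add0n|move=> ik]; apply: h;
  rewrite ?mem_iota.
Qed.

(** Uniqueness of measures on a pi-system: as functions of [A], both sides are finite measures, and
    mutual independence makes them agree on cylinders. *)
Lemma past_indep k A (B : set R) : <<s cylinder k >> A -> measurable B ->
  P (A `&` tau k @^-1` B) = (P A * P (tau k @^-1` B))%E.
Proof.
move=> sA mB.
have mtB : measurable (tau k @^-1` B) by exact: measurable_funPTI.
have PB0 : 0 <= fine (P (tau k @^-1` B)) by rewrite fine_ge0.
pose m1 : {measure set Omega -> \bar R} := mrestr P mtB.
pose m2 : {measure set Omega -> \bar R} := mscale (NngNum PB0) P.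
have PBE : (fine (P (tau k @^-1` B)))%:E = P (tau k @^-1` B).
  by rewrite fineK// fin_num_measure.
have m1E C : m1 C = P (C `&` tau k @^-1` B) by [].
have m2E C : m2 C = (P (tau k @^-1` B) * P C)%E by rewrite -PBE.
suff : m1 A = m2 A by rewrite m1E m2E muleC.
clearbody m1 m2.
apply: (g_sigma_algebra_measure_unique (cylinder k) _ (fun=> setT)) => //.
- exact: measurable_cylinder.
- by move=> _; exact: cylinderT.
- by rewrite bigcup_const//; exists 0%N.
- exact: cylinderI.
- move=> _ [C [mC ->]]; rewrite m1E m2E.
  (* Requiring [B] at index k turns the intersection into a cylinder over k + 1 durations; values of
     [C'] at larger indices are never consulted. *)
  pose C' i := if (i < k)%N then C i else B.
  have mC' i : measurable (C' i) by rewrite /C'; case: ifP.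
  have -> : [set w | forall i, (i < k)%N -> C i (tau i w)] `&` tau k @^-1` B =
      [set w | forall i, (i < k.+1)%N -> C' i (tau i w)].
    apply/seteqP; split => [w [h1 h2] i|w h] /=.
      rewrite ltnS leq_eqVlt /C' => /predU1P[->|ik]; first by rewrite ltnn.
      by rewrite ik; exact: h1.
    split => [i ik|]; first by have := h i (ltnW ik); rewrite /C' ik.
    by have := h k (ltnSn k); rewrite /C' ltnn.
  rewrite !prob_cylinder// -addn1 iotaD big_cat/= big_seq1 add0n.
  rewrite /C' ltnn muleC; congr (_ * _)%E; apply: eq_big_seq => i.
  by rewrite mem_iota add0n => /= ->.
- by move=> _; rewrite m1E setTI -PBE ltry.
Qed.

Definition to_past k (w : Omega) : past k := w.

Lemma measurable_to_past k : measurable_fun [set: Omega] (to_past k).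
Proof.
have mE : (measurable : set (set (past k))) = <<s cylinder k >> by [].
apply: (@measurability _ _ Omega (past k) _ _ _ mE) => _ [A cA <-].
by rewrite setTI; exact: (measurable_cylinder cA).
Qed.

Lemma measurable_past k i : (i < k)%N ->
  measurable_fun [set: past k] (fun w : past k => tau i w).
Proof.
move=> ik _ B mB; rewrite setTI; apply: sub_sigma_algebra.
exists (fun j => if j == i then B else setT); split=> [j|]; first by case: ifP.
apply/seteqP; split=> [w Bw j jk /=|w /= /(_ _ ik)]; last by rewrite eqxx.
by case: eqP => // ->.
Qed.

(* [lebesgue_measure] lives on [measurableTypeR R], which has the same measurable
   sets as [R] but is not convertible to it as a measurable type. *)
Definition interarrival k (w : Omega) : measurableTypeR R := tau k w.

Lemma measurable_interarrival k : measurable_fun [set: Omega] (interarrival k).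
Proof. by move=> _ B mB; rewrite setTI; exact: (measurable_funPTI (tau k) mB). Qed.

HB.instance Definition _ k :=
  isMeasurableFun.Build _ _ _ _ (interarrival k) (@measurable_interarrival k).

Definition interarrival_law k : probability (measurableTypeR R) R :=
  distribution P (interarrival k).

(** Serves as conditioning on the past: by independence the joint law of the past and the next
    duration is a product measure, so Tonelli integrates the duration first. *)
Lemma past_fubini k (h : past k * measurableTypeR R -> \bar R) :
  measurable_fun [set: past k * measurableTypeR R] h -> (forall x, 0 <= h x)%E ->
  (\int[P]_w h (to_past k w, interarrival k w) =
   \int[P]_w \int[interarrival_law k]_u h (to_past k w, u))%E.
Proof.
move=> mh h0.
pose X : {mfun Omega >-> past k} :=
  HB.pack (to_past k) (isMeasurableFun.Build _ _ _ _ _ (@measurable_to_past k)).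
pose Y : {mfun Omega >-> measurableTypeR R} := interarrival k.
have mXY : measurable_fun [set: Omega] (fun w => (X w, Y w)).
  by apply/measurable_fun_pairP; split; [exact: measurable_to_past|].
pose XY : {mfun Omega >-> (past k * measurableTypeR R)%type} :=
  HB.pack (fun w => (X w, Y w)) (isMeasurableFun.Build _ _ _ _ _ mXY).
pose PX := distribution P X; pose PY := distribution P Y.
pose PXY := distribution P XY.
have PXYE A : measurable A -> (PX \x PY)%E A = PXY A.
  apply: product_measure_unique => C D mC mD.
  by rewrite -[LHS]/(P (C `&` tau k @^-1` D)) past_indep.
transitivity (\int[PXY]_x h x)%E.
  by rewrite /PXY ge0_integral_pushforward.
transitivity (\int[PX \x PY]_x h x)%E.
  by apply: eq_measure_integral => A mA _; apply/esym; exact: PXYE.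
rewrite fubini_tonelli1// ge0_integral_pushforward//.
- exact: measurable_fun_fubini_tonelli_F.
- by move=> x _; apply: integral_ge0.
Qed.

End independence.

(** * Almost sure divergence of the jump times *)

Section good_outcome_ae.
Context {dT} {Omega : measurableType dT} {R : realType} (P : probability Omega R).
Variable tau : nat -> {RV P >-> R}.
Hypothesis tau_indep : mutual_indep P tau.
Hypothesis tau_law : forall k (A : set R), measurable A ->
  distribution P (tau k) A = exponential_prob (1 : R) A.

Local Notation interarrival_law := (interarrival_law tau).

Lemma interarrival_lawE k (A : set R) : measurable A ->
  interarrival_law k A = exponential_prob (1 : R) A.
Proof. exact: tau_law. Qed.

Lemma interarrival_gt0_ae : {ae P, forall w k, 0 < tau k w}.
Proof.
apply: ae_foralln => k; exists (tau k @^-1` `]-oo, 0]%classic); split.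
- by apply: measurable_funPTI.
- rewrite -[LHS]/(interarrival_law k `]-oo, 0]%classic).
  by rewrite (exponential_law_itvNyc (interarrival_lawE k))// oppr0 expR0 subrr.
- by move=> w /= /negP; rewrite -leNgt in_itv.
Qed.

(** If all durations from index n on were at most 1, so would be the first m of them, an event of
    probability q^m with q = 1 - exp(-1) < 1, whatever m. *)
Lemma interarrival_frequently_gt1_ae :
  {ae P, forall w n, exists2 i, (n <= i)%N & 1 < tau i w}.
Proof.
apply: ae_foralln => n.
pose q : R := 1 - expR (- 1).
have q01 : 0 <= q < 1.
  apply/andP; split; last by rewrite ltrBlDr ltrDl expR_gt0.
  by rewrite subr_ge0 -[leRHS]expR0 ler_expR lerN10.
have Pq i : P (tau i @^-1` `]-oo, 1]%classic) = q%:E.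
  exact: (exponential_law_itvNyc (interarrival_lawE i) ler01).
pose A := \bigcap_(i in [set i | (n <= i)%N]) (tau i @^-1` `]-oo, 1]%classic).
have mA : measurable A.
  by apply: bigcap_measurableType => i _; exact: measurable_funPTI.
exists A; split => //; last first.
  move=> w /= /forall2NP nw i /= ni; rewrite in_itv/=.
  by have [//|/negP] := nw i; rewrite -leNgt.
have PA m : (P A <= (q ^+ m)%:E)%E.
  have mI : forall i : nat, measurable (`]-oo, 1]%classic : set R) by [].
  have := tau_indep (iota_uniq n m) mI.
  under eq_bigr do rewrite Pq.
  have -> : (\prod_(i <- iota n m) q%:E = (q ^+ m)%:E)%E.
    by rewrite prodEFin big_const_seq count_predT size_iota -Monoid.iteropE.
  move=> <-; apply: le_measure; rewrite ?inE//.
    have -> : [set w | forall i, i \in iota n m -> `]-oo, 1]%classic (tau i w)] =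
        \bigcap_(i in [set i | i \in iota n m]) (tau i @^-1` `]-oo, 1]%classic) by [].
    by apply: bigcap_measurableType => i _; exact: measurable_funPTI.
  by move=> w Aw i; rewrite mem_iota => /andP[ni _]; exact: Aw.
have PAE : (fine (P A))%:E = P A by rewrite fineK// fin_num_measure.
apply: (etrans (esym PAE)); congr (_%:E); apply/eqP; rewrite eq_le fine_ge0// andbT.
case/andP: q01 => q0 q1.
have /cvgr_to_ge : q ^+ m @[m --> \oo] --> 0 by apply: cvg_expr; rewrite ger0_norm.
by apply; near=> m; rewrite -lee_fin PAE; exact: PA.
Unshelve. all: by end_near. Qed.

Lemma good_outcome_ae : {ae P, forall w, good_outcome tau w}.
Proof.
move: interarrival_gt0_ae interarrival_frequently_gt1_ae; apply: filterS2 => w t0 t1.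
split=> //.
have mono : {homo (fun k => jump_time tau k w) : k l / (k <= l)%N >-> k <= l}.
  apply: homo_leq => // [x y z|k]; first exact: le_trans.
  by rewrite /jump_time big_ord_recr/= lerDl ltW.
(* Each duration above 1 raises the nondecreasing jump times by at least 1, and there is always a
   later one. *)
have unb (M : nat) : exists k, M%:R <= jump_time tau k w.
  elim: M => [|M [k Mk]]; first by exists 0%N; rewrite /jump_time big_ord0.
  have [i ki ti] := t1 k; exists i.+1; rewrite /jump_time big_ord_recr/= -natr1.
  by rewrite lerD ?(ltW ti)// (le_trans Mk)//; exact: mono.
apply/cvgryPge => M; have [k Mk] := unb (Num.bound `|M|).
exists k => // l kl /=; apply: le_trans (mono _ _ kl); apply: le_trans Mk.
by rewrite (le_trans (ler_norm _))// ltW// archi_boundP.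
Qed.

End good_outcome_ae.

(** * States after jumps *)

Section post_jump_states.
Context {R : realType} {d : nat}.
Variables (f : 'rV[R]_d -> R) (xs : 'rV[R]_d) (L : R) (S : scheme R).
Hypothesis adm : admissible f xs L S.
Implicit Types (y : 'rV[R]_d * 'rV[R]_d).

Local Notation lyap := (lyap f xs S).
Local Notation flow := (flow S).
Local Notation gstep := (gstep f L S).

(* The absolute value only matters on the null set of outcomes with a negative
   duration; it keeps jump times nonnegative everywhere. *)
Definition next_time (st : R * ('rV[R]_d * 'rV[R]_d)) (u : R) := st.1 + `|u|.

Definition next_state (st : R * ('rV[R]_d * 'rV[R]_d)) (u : R) :=
  (next_time st u, gstep (next_time st u) (flow st.1 (next_time st u) st.2)).

Fixpoint post_jump y0 (e : nat -> R) k :=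
  if k is k'.+1 then next_state (post_jump y0 e k') (e k') else (0, y0).

Lemma post_jump_time_ge0 y0 e k : 0 <= (post_jump y0 e k).1.
Proof. by elim: k => //= k IH; rewrite addr_ge0. Qed.

(** This makes the k-th state a function of the past of k durations. *)
Lemma eq_post_jump y0 e e' k : (forall i, (i < k)%N -> e i = e' i) ->
  post_jump y0 e k = post_jump y0 e' k.
Proof.
elim: k => [//|k IH ee' /=]; congr next_state; last exact: ee'.
by apply: IH => i ik; apply: ee'; rewrite ltnS ltnW.
Qed.

Section measurability.
Context {dT} {T : measurableType dT}.
Implicit Types (s u : T -> R) (x z : T -> 'rV[R]_d) (st : T -> R * ('rV[R]_d * 'rV[R]_d)).

Local Notation measurable_state st := ([/\ measurable_fun [set: T] (fun w => (st w).1),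
  measurable_coords (fun w => (st w).2.1) & measurable_coords (fun w => (st w).2.2)]).

Lemma measurable_continuous_comp1 (g : R -> R) s : continuous g ->
  measurable_fun [set: T] s -> measurable_fun [set: T] (fun w => g (s w)).
Proof. by move=> cg ms; apply: measurableT_comp => //; exact: continuous_measurable_fun. Qed.

Lemma measurable_coordsB x z : measurable_coords x -> measurable_coords z ->
  measurable_coords (fun w => x w - z w).
Proof.
move=> mx mz i; under eq_fun do rewrite mxE [X in _ + X]mxE.
exact: measurable_funB.
Qed.

Lemma measurable_coordsZ s x : measurable_fun [set: T] s -> measurable_coords x ->
  measurable_coords (fun w => s w *: x w).
Proof. by move=> ms mx i; under eq_fun do rewrite mxE; exact: measurable_funM. Qed.

Lemma measurable_coordsD x z : measurable_coords x -> measurable_coords z ->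
  measurable_coords (fun w => x w + z w).
Proof. by move=> mx mz i; under eq_fun do rewrite mxE; exact: measurable_funD. Qed.

Lemma measurable_sqnorm x : measurable_coords x ->
  measurable_fun [set: T] (fun w => sqnorm (x w)).
Proof.
by move=> mx; apply: measurable_sum => i; exact: measurable_funM.
Qed.

Lemma measurable_flow s u x z : measurable_fun [set: T] s -> measurable_fun [set: T] u ->
  measurable_coords x -> measurable_coords z ->
  measurable_coords (fun w => (flow (s w) (u w) (x w, z w)).1) /\
  measurable_coords (fun w => (flow (s w) (u w) (x w, z w)).2).
Proof.
move=> ms mu mx mz; have [max maz] := adm_mix_meas adm.
have msu : measurable_fun [set: T] (fun w => (s w, u w)).
  exact/measurable_fun_pairP.
by split; apply: measurable_coordsD => //; apply: measurable_coordsZ;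
  do ?[exact: measurable_coordsB]; [exact: (measurableT_comp max msu)|
  exact: (measurableT_comp maz msu)].
Qed.

Lemma measurable_gstep u x z : measurable_fun [set: T] u ->
  measurable_coords x -> measurable_coords z ->
  measurable_coords (fun w => (gstep (u w) (x w, z w)).1) /\
  measurable_coords (fun w => (gstep (u w) (x w, z w)).2).
Proof.
move=> mu mx mz; have [_ _ _ _ cg] := adm_cont adm.
have mG : measurable_coords (fun w => grad f (x w)).
  move=> i; apply: (@measurable_continuous_comp _ _ _ _ (fun v => grad f v 0 i)) => //.
  move=> v; apply: (@cvg_coord _ _ _ _ (nbhs_filter v) (grad f) (grad f v)).
  exact: (continuous_grad (adm_L adm) (adm_convex adm) (adm_diff adm) (adm_smooth adm)).
split; apply: measurable_coordsB => //; apply: measurable_coordsZ => //.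
exact: measurable_continuous_comp1.
Qed.

Lemma measurable_lyap u x z : measurable_fun [set: T] u ->
  measurable_coords x -> measurable_coords z ->
  measurable_fun [set: T] (fun w => lyap (u w) (x w, z w)).
Proof.
move=> mu mx mz; have [cA cB] := continuous_wt adm.
apply: measurable_funD; apply: measurable_funM; do ?exact: measurable_continuous_comp1.
  apply: measurable_funB => //.
  exact: (measurable_continuous_comp (continuous_objective adm)).
by apply: measurable_sqnorm; apply: measurable_coordsB => // i; exact: measurable_cst.
Qed.

Lemma measurable_next_state st u : measurable_state st ->
  measurable_fun [set: T] u -> measurable_state (fun w => next_state (st w) (u w)).
Proof.
move=> [ms mx mz] mu.
have mn : measurable_fun [set: T] (fun w => next_time (st w) (u w)).
  by apply: measurable_funD => //; exact: measurableT_comp.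
have [mx' mz'] := measurable_flow ms mn mx mz.
have [mx'' mz''] := measurable_gstep mn mx' mz'.
by split; [exact: mn|exact: mx''|exact: mz''].
Qed.

Lemma measurable_post_jump y0 (e : nat -> T -> R) k :
  (forall i, (i < k)%N -> measurable_fun [set: T] (e i)) ->
  measurable_state (fun w => post_jump y0 (e ^~ w) k).
Proof.
elim: k => [_|k IH me] /=; first by split => // i; exact: measurable_cst.
apply: measurable_next_state; last exact: me.
by apply: IH => i ik; apply: me; rewrite ltnS ltnW.
Qed.

End measurability.
End post_jump_states.

(** * The telescoping bound in expectation *)

Section expected_lyapunov.
Context {R : realType} {d : nat}.
Variables (f : 'rV[R]_d -> R) (xs : 'rV[R]_d) (L : R) (S : scheme R).
Hypothesis adm : admissible f xs L S.
Implicit Types (st : R * ('rV[R]_d * 'rV[R]_d)).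

Local Notation lyap := (lyap f xs S).
Local Notation flow := (flow S).
Local Notation gstep := (gstep f L S).
Local Notation next_state := (next_state f L S).
Local Notation post_jump := (post_jump f L S).

(** Extension by zero puts the events T_k <= t, here and T_k <= t < T_(k+1), below, inside the
    integrands. *)
Definition lyap_before t st := if st.1 <= t then lyap st.1 st.2 else 0.

Definition lyap_between t st u :=
  if (st.1 <= t) && (t < next_time st u) then lyap t (flow st.1 t st.2) else 0.

Lemma lyap_before_ge0 t st : 0 <= st.1 -> 0 <= lyap_before t st.
Proof. by move=> s0; rewrite /lyap_before; case: ifP => // _; exact: (lyap_ge0 adm). Qed.

Lemma lyap_between_ge0 t st u : 0 <= t -> 0 <= lyap_between t st u.
Proof. by move=> t0; rewrite /lyap_between; case: ifP => // _; exact: (lyap_ge0 adm). Qed.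

Section measurability.
Context {dT} {T : measurableType dT}.
Variables (st : T -> R * ('rV[R]_d * 'rV[R]_d)) (u : T -> R) (t : R).
Hypotheses (ms : measurable_fun [set: T] (fun w => (st w).1))
  (mx : measurable_coords (fun w => (st w).2.1))
  (mz : measurable_coords (fun w => (st w).2.2))
  (mu : measurable_fun [set: T] u).

Lemma measurable_lyap_before : measurable_fun [set: T] (fun w => lyap_before t (st w)).
Proof.
apply: measurable_fun_if => //; first exact: measurable_fun_ler.
apply: measurable_funTS.
exact: (measurable_lyap adm ms mx mz).
Qed.

Lemma measurable_lyap_between :
  measurable_fun [set: T] (fun w => lyap_between t (st w) (u w)).
Proof.
apply: measurable_fun_if => //.
  apply: measurable_and; first exact: measurable_fun_ler.
  apply: measurable_fun_ltr => //.
  by apply: measurable_funD => //; exact: measurableT_comp.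
apply: measurable_funTS.
have mt : measurable_fun [set: T] (fun=> t) by [].
have [mx' mz'] := measurable_flow adm ms mt mx mz.
exact: (measurable_lyap adm mt mx' mz').
Qed.

End measurability.

(** The state is frozen and only the next duration is random, so [lyap_step] applies with [a] the
    time left before t: shorter durations give its integral term, longer ones its boundary term. *)
Lemma integral_lyap_next (m : probability (measurableTypeR R) R) t st :
  (forall A : set R, measurable A -> m A = exponential_prob (1 : R) A) ->
  0 <= st.1 ->
  (\int[m]_u (lyap_before t (next_state st u) + lyap_between t st u)%:E <=
   (lyap_before t st)%:E)%E.
Proof.
case: st => s y /= mE s0.
have -> : lyap_before t (s, y) = if s <= t then lyap s y else 0 by [].
have [st|ts] := leP s t; last first.
  rewrite integral0_eq// => u _; rewrite /lyap_before /lyap_between /= leNgt.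
  by rewrite (lt_le_trans ts) ?lerDl//= [s <= t]leNgt ts addr0.
pose a := t - s; have a0 : 0 <= a by rewrite subr_ge0.
have t0 : 0 <= t by exact: le_trans st.
have saE : s + a = t by rewrite addrC subrK.
pose c := lyap t (flow s t y); have c0 : 0 <= c by exact: (lyap_ge0 adm).
pose h u := lyap_before t (next_state (s, y) u) + lyap_between t (s, y) u.
have h0 u : (0 <= (h u)%:E)%E.
  rewrite lee_fin addr_ge0 ?lyap_between_ge0//.
  by apply: lyap_before_ge0; rewrite /next_time /= addr_ge0.
have hE u : 0 <= u -> h u =
    (if s + u <= t then lyap (s + u) (gstep (s + u) (flow s (s + u) y)) else 0) +
    (if t < s + u then c else 0).
  move=> u0; have nE : next_time (s, y) u = s + u by rewrite /next_time ger0_norm.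
  by rewrite /h /lyap_before /lyap_between /next_state nE /= st.
have hc u : a < u -> (h u)%:E = c%:E.
  move=> au; have u0 : 0 <= u by rewrite (le_trans a0)// ltW.
  have tu : t < s + u by rewrite -ltrBlDl.
  by rewrite hE// tu leNgt tu add0r.
have ha u : 0 <= u <= a -> h u = lyap (s + u) (gstep (s + u) (flow s (s + u) y)).
  move=> /andP[u0 ua]; have ut : s + u <= t by rewrite -lerBrDl.
  by rewrite hE// ut ltNge ut addr0.
have mh : measurable_fun [set: R] (EFin \o h).
  apply/measurable_EFinP.
  have mst : [/\ measurable_fun [set: R] (fun u : R => s),
      measurable_coords (fun u : R => y.1) & measurable_coords (fun u : R => y.2)].
    by split => // i; exact: measurable_cst.
  have mid : measurable_fun [set: R] (fun u : R => u) by exact: measurable_id.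
  have [m1 m2 m3] := @measurable_next_state _ _ _ _ _ _ adm _ R (fun=> (s, y)) id mst mid.
  have [m4 m5 m6] := mst.
  apply: measurable_funD; first exact: measurable_lyap_before.
  exact: (@measurable_lyap_between _ R (fun=> (s, y)) id).
rewrite (integral_exponential_law mE a0 c0 mh h0 hc).
apply: le_trans (lyap_step adm y s0 a0).
rewrite saE leeD2r//.
rewrite le_eqVlt; apply/orP; left; apply/eqP; apply: eq_integral => u.
by rewrite inE/= in_itv/= => /ha; rewrite /= => ->; rewrite -EFinM mulrC.
Qed.

Context {dT} {Omega : measurableType dT} (P : probability Omega R).
Variable tau : nat -> {RV P >-> R}.
Hypothesis tau_indep : mutual_indep P tau.
Hypothesis tau_law : forall k (A : set R), measurable A ->
  distribution P (tau k) A = exponential_prob (1 : R) A.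
Variables (y0 : 'rV[R]_d * 'rV[R]_d) (t : R).
Hypothesis t0 : 0 <= t.

Definition state k w := post_jump y0 (fun i => tau i w) k.

Lemma state_time_ge0 k w : 0 <= (state k w).1.
Proof. exact: post_jump_time_ge0. Qed.

Lemma measurable_state k :
  [/\ measurable_fun [set: Omega] (fun w => (state k w).1),
    measurable_coords (fun w => (state k w).2.1) &
    measurable_coords (fun w => (state k w).2.2)].
Proof.
exact: (@measurable_post_jump _ _ _ _ _ _ adm _ Omega y0 (fun i w => tau i w)).
Qed.

Lemma measurable_before k :
  measurable_fun [set: Omega] (fun w => (lyap_before t (state k w))%:E).
Proof.
apply/measurable_EFinP; have [m1 m2 m3] := measurable_state k.
exact: measurable_lyap_before.
Qed.

Lemma measurable_between k :
  measurable_fun [set: Omega] (fun w => (lyap_between t (state k w) (tau k w))%:E).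
Proof.
apply/measurable_EFinP; have [m1 m2 m3] := measurable_state k.
exact: measurable_lyap_between.
Qed.

Lemma expected_lyap_next k :
  (\int[P]_w (lyap_before t (state k.+1 w))%:E +
   \int[P]_w (lyap_between t (state k w) (tau k w))%:E <=
   \int[P]_w (lyap_before t (state k w))%:E)%E.
Proof.
(* The default 0 at indices from [k] on removes the durations that are not measurable for the past;
   the k-th state does not read them. *)
pose st (p : past tau k * measurableTypeR R) : R * ('rV[R]_d * 'rV[R]_d) :=
  post_jump y0 (fun i => if (i < k)%N then tau i p.1 else 0) k.
pose h (p : past tau k * measurableTypeR R) : \bar R :=
  (lyap_before t (next_state (st p) p.2) + lyap_between t (st p) p.2)%:E.
have stE w u : st (w, u) = state k w by apply: eq_post_jump => i ->.
have mst : [/\ measurable_fun [set: past tau k * measurableTypeR R] (fun p => (st p).1),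
    measurable_coords (fun p => (st p).2.1) & measurable_coords (fun p => (st p).2.2)].
  apply: (@measurable_post_jump _ _ _ _ _ _ adm _ (past tau k * measurableTypeR R)%type
    y0 (fun i p => if (i < k)%N then tau i p.1 else 0)) => i ik; rewrite ik.
  by apply: (measurableT_comp (measurable_past ik)); exact: measurable_fst.
have [m1 m2 m3] := mst.
have m4 : measurable_fun [set: past tau k * measurableTypeR R] (fun p => p.2 : R).
  exact: measurable_snd.
have [n1 n2 n3] := measurable_next_state adm mst m4.
have mh : measurable_fun [set: past tau k * measurableTypeR R] h.
  apply/measurable_EFinP; apply: measurable_funD; first exact: measurable_lyap_before.
  exact: measurable_lyap_between.
have stp0 p : 0 <= (st p).1 by exact: post_jump_time_ge0.
have h0 p : (0 <= h p)%E.
  rewrite lee_fin addr_ge0 ?lyap_between_ge0//; apply: lyap_before_ge0 => /=.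
  by rewrite addr_ge0.
have key w : (\int[interarrival_law tau k]_u h (to_past tau k w, u) <=
    (lyap_before t (state k w))%:E)%E.
  have <- : (\int[interarrival_law tau k]_u (lyap_before t (next_state (state k w) u) +
      lyap_between t (state k w) u)%:E =
      \int[interarrival_law tau k]_u h (to_past tau k w, u))%E.
    by apply: eq_integral => u _; rewrite /h stE.
  apply: integral_lyap_next; first exact: tau_law.
  exact: state_time_ge0.
rewrite -ge0_integralD//; last 4 first.
- by move=> w _; rewrite lee_fin lyap_before_ge0// state_time_ge0.
- exact: measurable_before.
- by move=> w _; rewrite lee_fin lyap_between_ge0.
- exact: measurable_between.
have -> : (\int[P]_w ((lyap_before t (state k.+1 w))%:E +
    (lyap_between t (state k w) (tau k w))%:E) =
    \int[P]_w h (to_past tau k w, interarrival tau k w))%E.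
  by apply: eq_integral => w _; rewrite /h stE -EFinD.
rewrite (past_fubini tau_indep mh h0); apply: ge0_le_integral => //.
- by move=> w _; apply: integral_ge0.
- apply: (measurableT_comp (measurable_fun_fubini_tonelli_F _ mh h0)).
  exact: measurable_to_past.
- exact: measurable_before.
Qed.

Lemma expected_lyap_between_sum :
  (\sum_(k <oo) \int[P]_w (lyap_between t (state k w) (tau k w))%:E <=
   (lyap 0 y0)%:E)%E.
Proof.
have B0 k w : (0 <= (lyap_between t (state k w) (tau k w))%:E)%E.
  by rewrite lee_fin lyap_between_ge0.
apply: lime_le.
  by apply: is_cvg_nneseries => k _ _; apply: integral_ge0 => w _.
apply: nearW => n.
(* Restoring the nonnegative remainder at step n gives a bound that [expected_lyap_next] propagates
   by induction; at n = 0 it is the initial value. *)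
apply: (@le_trans _ _ (\sum_(0 <= k < n) \int[P]_w (lyap_between t (state k w) (tau k w))%:E
   + \int[P]_w (lyap_before t (state n w))%:E)%E).
  rewrite leeDl// integral_ge0// => w _.
  by rewrite lee_fin lyap_before_ge0// state_time_ge0.
elim: n => [|n IH].
  rewrite big_nil add0e.
  rewrite (_ : (fun _ => _) = cst (lyap 0 y0)%:E).
    by rewrite integral_cst//= probability_setT mule1.
  by apply/funext => w; rewrite /lyap_before /= t0.
apply: le_trans IH; rewrite big_nat_recr//= -addeA leeD2l// addeC.
exact: expected_lyap_next.
Qed.

End expected_lyapunov.

(** * Identification of the paths *)

Section linear_ode.
Context {R : realType}.
Implicit Types (g dg a b eta : R -> R) (s e t l : R).

(** Derivatives are known only strictly between jumps, so monotonicity is used on [r, t] and r then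
    decreases to s. *)
Lemma le_right_limit g dg s e l t :
  (forall u, s < u < e -> is_derive u 1 g (dg u)) ->
  (forall u, s < u < e -> dg u <= 0) ->
  g r @[r --> s^'+] --> l -> s < t < e -> g t <= l.
Proof.
move=> gd dg0 gl /andP[st te]; apply: (cvgr_to_ge gl); near=> r.
have sr : s < r by near: r; exact: nbhs_right_gt.
have rt : r < t by near: r; exact: nbhs_right_lt.
have sue u : r <= u -> u <= t -> s < u < e.
  by move=> ru ut; rewrite (lt_le_trans sr ru) (le_lt_trans ut te).
apply: (@ler0_derive1_nincr _ g r t) => //; last exact: ltW.
- by move=> u; rewrite in_itv/= => /andP[/ltW ru /ltW ut]; case: (gd u (sue _ ru ut)).
- move=> u; rewrite in_itv/= => /andP[/ltW ru /ltW ut]; rewrite derive1E.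
  by have [_ ->] := gd u (sue _ ru ut); apply/dg0/sue.
- apply: continuous_in_subspaceT => u; rewrite inE/= in_itv/= => /andP[ru ut].
  apply: differentiable_continuous; apply/derivable1_diffP.
  by case: (gd u (sue _ ru ut)).
Unshelve. all: by end_near. Qed.

Lemma eq_right_limit g s e l t :
  (forall u, s < u < e -> is_derive u 1 g 0) ->
  g r @[r --> s^'+] --> l -> s < t < e -> g t = l.
Proof.
move=> gd gl ste; apply/eqP; rewrite eq_le; apply/andP; split.
  exact: (@le_right_limit g (cst 0) s e l t gd _ gl ste).
rewrite -lerN2; apply: (@le_right_limit (- g) (cst 0) s e (- l) t) => //.
  by move=> u /gd dgu; rewrite -oppr0; exact: is_deriveN.
exact: cvgN.
Qed.

(* The square of [a - b] is nonincreasing, so that [a] and [b] coincide, and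
   then both have a zero derivative. *)
Lemma linear_ode_zero a b eta (eta' : R -> R) s e t :
  (forall u, s < u < e -> 0 <= eta u /\ 0 <= eta' u) ->
  (forall u, s < u < e -> is_derive u 1 a (eta u * (b u - a u))) ->
  (forall u, s < u < e -> is_derive u 1 b (eta' u * (a u - b u))) ->
  a r @[r --> s^'+] --> 0 -> b r @[r --> s^'+] --> 0 ->
  s < t < e -> a t = 0 /\ b t = 0.
Proof.
move=> eta0 da db a0 b0 ste.
have ab u : s < u < e -> a u = b u.
  move=> sue; apply/eqP; rewrite -subr_eq0 -sqrf_eq0 eq_le sqr_ge0 andbT.
  have -> : (a u - b u) ^+ 2 = ((a - b) ^+ 2) u by [].
  pose dg v := - (2 * (eta v + eta' v) * (a v - b v) ^+ 2).
  apply: (@le_right_limit _ dg s e) => //.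
  - move=> v sve; have dav := da _ sve; have dbv := db _ sve.
    apply: is_derive_eq; rewrite /dg -[LHS]/((2%:R * (a v - b v) ^+ 1) *
      (eta v * (b v - a v) - eta' v * (a v - b v))).
    by ring.
  - move=> v /eta0[e0 e0']; rewrite oppr_le0 mulr_ge0 ?sqr_ge0//.
    by rewrite mulr_ge0// addr_ge0.
  - have c : (a - b) r @[r --> s^'+] --> (0 - 0 : R) by exact: cvgB.
    suff : ((a - b) * (a - b)) r @[r --> s^'+] --> ((0 - 0) * (0 - 0) : R).
      by rewrite subr0 mulr0.
    exact: cvgM.
have az : a t = 0.
  apply: (@eq_right_limit a s e) => // u sue.
  by have := da _ sue; rewrite ab// subrr mulr0.
by split => //; rewrite -ab.
Qed.

Lemma is_derive_affine_gap (p m : R -> R) (c c' dp dm u : R) :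
  is_derive u 1 p dp -> is_derive u 1 m dm ->
  is_derive u 1 (fun v => p v - (c + m v * c')) (dp - dm * c').
Proof.
move=> hp hm.
have -> : (fun v => p v - (c + m v * c')) = p - (cst c + c' \*: m).
  by apply/funext => v; rewrite /= mulrC.
by apply: is_derive_eq; rewrite add0r -[c' *: dm]/(c' * dm) mulrC.
Qed.

End linear_ode.

Section path_identification.
Context {R : realType} {d : nat}.
Variables (f : 'rV[R]_d -> R) (xs : 'rV[R]_d) (L : R) (S : scheme R).
Hypothesis adm : admissible f xs L S.
Implicit Types (y : 'rV[R]_d * 'rV[R]_d) (s e t : R) (x z : R -> 'rV[R]_d).

Local Notation lyap := (lyap f xs S).
Local Notation flow := (flow S).
Local Notation gstep := (gstep f L S).
Local Notation next_state := (next_state f L S).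
Local Notation post_jump := (post_jump f L S).

Lemma is_derive_coord x t (v : 'rV[R]_d) i : is_derive t 1 x v ->
  is_derive t 1 (fun u => x u 0 i) (v 0 i).
Proof.
move=> [dx xv]; split; first by move/derivable_mxP : dx; exact.
by rewrite -xv derive_mx// mxE.
Qed.

(** Coordinate by coordinate, the difference between the path and the flow solves the same linear
    system with right limit zero. The right limits are compared with [flow s s y], which may differ
    from [y] at a singular start. *)
Lemma flow_unique s e y x z t : 0 <= s ->
  (forall u, s < u -> u < e -> is_derive u 1 x (eta_x S u *: (z u - x u)) /\
    is_derive u 1 z (eta_z S u *: (x u - z u))) ->
  x r @[r --> s^'+] --> (flow s s y).1 -> z r @[r --> s^'+] --> (flow s s y).2 ->
  s < t -> t < e -> (x t, z t) = flow s t y.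
Proof.
move=> s0 xz cx cz st te.
have [fx fz] := cvg_flow adm y s0 (lexx s).
suff xzE i : x t 0 i - (flow s t y).1 0 i = 0 /\ z t 0 i - (flow s t y).2 0 i = 0.
  rewrite [RHS]surjective_pairing; congr pair; apply/rowP => i; have [hx hz] := xzE i.
    by apply/eqP; rewrite -subr_eq0 hx.
  by apply/eqP; rewrite -subr_eq0 hz.
pose a u := x u 0 i - (flow s u y).1 0 i; pose b u := z u 0 i - (flow s u y).2 0 i.
have aE u : s < u < e -> is_derive u 1 a (eta_x S u * (b u - a u)).
  move=> /andP[su ue]; have [/is_derive_coord dx _] := xz u su ue.
  have := is_derive_affine_gap (y.1 0 i) (y.2 0 i - y.1 0 i) (dx i) (adm_mix_x adm s0 su).
  rewrite (_ : (fun v => _ - _) = a); last by apply/funext => v; rewrite /a /flow /= !mxE.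
  by congr (is_derive _ _ _ _); rewrite /b /a /flow /= !mxE; ring.
have bE u : s < u < e -> is_derive u 1 b (eta_z S u * (a u - b u)).
  move=> /andP[su ue]; have [_ /is_derive_coord dz] := xz u su ue.
  have := is_derive_affine_gap (y.2 0 i) (y.1 0 i - y.2 0 i) (dz i) (adm_mix_z adm s0 su).
  rewrite (_ : (fun v => _ - _) = b); last by apply/funext => v; rewrite /b /flow /= !mxE.
  by congr (is_derive _ _ _ _); rewrite /b /a /flow /= !mxE; ring.
have ca : a r @[r --> s^'+] --> (flow s s y).1 0 i - (flow s s y).1 0 i.
  apply: cvgB; apply: cvg_coord; first exact: cx.
  exact: (cvg_at_right_filter fx).
have cb : b r @[r --> s^'+] --> (flow s s y).2 0 i - (flow s s y).2 0 i.
  apply: cvgB; apply: cvg_coord; first exact: cz.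
  exact: (cvg_at_right_filter fz).
rewrite subrr in ca; rewrite subrr in cb.
apply: (@linear_ode_zero _ a b (eta_x S) (eta_z S) s e t _ aE bE ca cb).
- by move=> u /andP[su _]; apply: (adm_eta adm); exact: le_lt_trans su.
- by rewrite st.
Qed.

Lemma flow_start s y : 0 < s -> flow s s y = y.
Proof.
move=> s0; rewrite /flow (adm_mix_z0 adm (ltW s0)) scale0r addr0.
have [->|[sE _]] := adm_mix_x0 adm (ltW s0); last by rewrite sE ltxx in s0.
by rewrite scale0r addr0 -surjective_pairing.
Qed.

Section path.
Context {dT} {Omega : measurableType dT} (P : probability Omega R).
Variables (tau : nat -> {RV P >-> R}) (w : Omega) (y0 : 'rV[R]_d * 'rV[R]_d).
Variables (x z : R -> 'rV[R]_d).
Hypothesis good : good_outcome tau w.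
Hypothesis start : flow 0 0 y0 = y0.
Hypotheses (x_start : x r @[r --> 0^'+] --> y0.1) (z_start : z r @[r --> 0^'+] --> y0.2).
Hypothesis path : continuized_path f (eta_x S) (eta_z S) (fun _ => L^-1) (step_z S)
  (fun k => jump_time tau k w) x z.

Local Notation T k := (jump_time tau k w).
Local Notation Y k := (post_jump y0 (fun i => tau i w) k).

Lemma jump_timeS k : T k.+1 = T k + tau k w.
Proof. by rewrite /jump_time big_ord_recr. Qed.

Lemma jump_time_lt k : T k < T k.+1.
Proof. by rewrite jump_timeS ltrDl; case: good. Qed.

Lemma jump_time_ge0 k : 0 <= T k.
Proof.
elim: k => [|k IH]; first by rewrite /jump_time big_ord0.
by rewrite (le_trans IH)// ltW// jump_time_lt.
Qed.

Lemma post_jump_timeE k : (Y k).1 = T k.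
Proof.
elim: k => [|k IH] /=; first by rewrite /jump_time big_ord0.
by rewrite /next_time IH jump_timeS gtr0_norm//; case: good.
Qed.

Lemma path_on_interval k :
  [/\ flow (T k) (T k) (Y k).2 = (Y k).2, x r @[r --> (T k)^'+] --> (Y k).2.1 &
    z r @[r --> (T k)^'+] --> (Y k).2.2] ->
  forall t, T k < t -> t < T k.+1 -> (x t, z t) = flow (T k) t (Y k).2.
Proof.
move=> [fE cx cz] t Tt tT; have [ode _ _] := path.
by apply: (@flow_unique _ (T k.+1)) => //; rewrite ?fE//; [exact: jump_time_ge0|exact: ode].
Qed.

(** Both claims go through one induction: right limits at T_k identify the path with the flow up to
    T_(k+1), hence its left limits there and the state after the jump; right-continuity turns that
    state into the next right limits. *)
Lemma path_after_jump k :
  [/\ flow (T k) (T k) (Y k).2 = (Y k).2, x r @[r --> (T k)^'+] --> (Y k).2.1 &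
    z r @[r --> (T k)^'+] --> (Y k).2.2] /\
  (x (T k.+1), z (T k.+1)) = (Y k.+1).2.
Proof.
have jump j : [/\ flow (T j) (T j) (Y j).2 = (Y j).2,
      x r @[r --> (T j)^'+] --> (Y j).2.1 & z r @[r --> (T j)^'+] --> (Y j).2.2] ->
    (x (T j.+1), z (T j.+1)) = (Y j.+1).2.
  move=> Ij; have [_ _ /(_ j)[xm [zm [cxm czm -> ->]]]] := path.
  have [cfx cfz] := cvg_flow adm (Y j).2 (jump_time_ge0 j) (ltW (jump_time_lt j)).
  have near_flow : \forall r \near (T j.+1)^'-, (x r, z r) = flow (T j) r (Y j).2.
    near=> r.
    have h1 : T j < r by near: r; apply: nbhs_left_gt; exact: jump_time_lt.
    have h2 : r < T j.+1 by near: r; exact: nbhs_left_lt.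
    exact: path_on_interval.
  have cxm' : x r @[r --> (T j.+1)^'-] --> (flow (T j) (T j.+1) (Y j).2).1.
    apply: cvg_trans (cvg_at_left_filter cfx); apply: near_eq_cvg.
    by apply: filterS near_flow => r <-.
  have czm' : z r @[r --> (T j.+1)^'-] --> (flow (T j) (T j.+1) (Y j).2).2.
    apply: cvg_trans (cvg_at_left_filter cfz); apply: near_eq_cvg.
    by apply: filterS near_flow => r <-.
  have xmE := norm_cvg_unique cxm cxm'; have zmE := norm_cvg_unique czm czm'.
  rewrite xmE zmE /= /next_time post_jump_timeE gtr0_norm -?jump_timeS//.
  by case: good.
elim: k => [|k [Ik Jk]].
  have I0 : [/\ flow (T 0) (T 0) (Y 0).2 = (Y 0).2,
      x r @[r --> (T 0)^'+] --> (Y 0).2.1 & z r @[r --> (T 0)^'+] --> (Y 0).2.2].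
    by rewrite /= /jump_time big_ord0.
  by split; [exact: I0|exact: jump I0].
(* Right-continuity and [flow_start] are available at positive times only; time 0 was settled by the
   hypotheses on the start. *)
have Tpos : 0 < T k.+1 by rewrite (le_lt_trans (jump_time_ge0 k))// jump_time_lt.
have Ik1 : [/\ flow (T k.+1) (T k.+1) (Y k.+1).2 = (Y k.+1).2,
      x r @[r --> (T k.+1)^'+] --> (Y k.+1).2.1 & z r @[r --> (T k.+1)^'+] --> (Y k.+1).2.2].
  have [_ /(_ _ Tpos)[cx cz] _] := path.
  by rewrite -Jk; split => //; exact: flow_start.
split; [exact: Ik1|exact: jump Ik1].
Unshelve. all: by end_near. Qed.

(** The index is that of the last jump time not after t; the distance term of [lyap] is nonnegative
    and dropped. The alternative on [x 0] serves t = 0, where the value of the path may differ from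
    its right limit. *)
Lemma path_lyap t : 0 <= t -> (wt_f S 0 = 0 \/ x 0 = y0.1) ->
  exists k, wt_f S t * (f (x t) - f xs) <= lyap_between f xs S t (Y k) (tau k w).
Proof.
move=> t0 x0.
have ex : exists k, t < T k.
  have [_ /cvgryPgt/(_ t)[k _ kt]] := good; exists k; exact: kt (leqnn k).
case: (ex_minnP ex) => -[|k] tk kmin.
  by rewrite /jump_time big_ord0 ltNge t0 in tk.
have Tkt : T k <= t by rewrite leNgt; apply/negP => /kmin; rewrite ltnn.
exists k; rewrite /lyap_between /next_time post_jump_timeE gtr0_norm; last by case: good.
rewrite -jump_timeS Tkt tk /=.
have le_lyap v v' : wt_f S t * (f v - f xs) <= lyap t (v, v').
  by rewrite /lyap /= lerDl mulr_ge0 ?sqnorm_ge0// (adm_wt_z adm).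
have [Ik _] := path_after_jump k.
(* At t = T_k the flow description on the open interval is silent: the state after the jump is used
   if k > 0, and the assumption on time 0 otherwise. *)
move: Tkt; rewrite le_eqVlt => /predU1P[Tkt|Tkt].
  rewrite -Tkt; have [-> _ _] := Ik; rewrite Tkt.
  case: k {Ik kmin tk} Tkt => [|k] Tkt; last first.
    by have [_ <-] := path_after_jump k; rewrite Tkt.
  move: Tkt; rewrite /jump_time big_ord0 => t00; rewrite -t00 /=.
  have [->|->] := x0; last by rewrite t00 [y0 in leRHS]surjective_pairing.
  by rewrite mul0r (lyap_ge0 adm).
by rewrite -(path_on_interval Ik).
Qed.

End path.
End path_identification.

(** * From the Lyapunov bound to the objective *)

Section expected_objective.
Context {R : realType} {d : nat}.
Variables (f : 'rV[R]_d -> R) (xs : 'rV[R]_d) (L : R) (S : scheme R).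
Hypothesis adm : admissible f xs L S.
Context {dT} {Omega : measurableType dT} (P : probability Omega R).
Variable tau : nat -> {RV P >-> R}.
Hypothesis tau_indep : mutual_indep P tau.
Hypothesis tau_law : forall k (A : set R), measurable A ->
  distribution P (tau k) A = exponential_prob (1 : R) A.
Variables (y0 : 'rV[R]_d * 'rV[R]_d) (x z : Omega -> R -> 'rV[R]_d).
Hypothesis start : flow S 0 0 y0 = y0.
Hypothesis path : forall w, good_outcome tau w ->
  [/\ wt_f S 0 = 0 \/ x w 0 = y0.1, x w r @[r --> 0^'+] --> y0.1,
    z w r @[r --> 0^'+] --> y0.2 &
    continuized_path f (eta_x S) (eta_z S) (fun _ => L^-1) (step_z S)
      (fun k => jump_time tau k w) (x w) (z w)].

Lemma expected_objective t : 0 <= t -> 0 < wt_f S t ->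
  measurable_fun [set: Omega] (fun w => f (x w t)) ->
  ('E_P[fun w => f (x w t)] - (f xs)%:E <= (lyap f xs S 0 y0 / wt_f S t)%:E)%E.
Proof.
move=> t0 A0 mf; set A := wt_f S t in A0 *.
pose g w := f (x w t) - f xs.
have g0 w : 0 <= g w by rewrite subr_ge0 (adm_min adm).
have mg : measurable_fun [set: Omega] (fun w => (g w)%:E).
  by apply/measurable_EFinP; exact: measurable_funB.
pose B k w := (lyap_between f xs S t (state f L S tau y0 k w) (tau k w))%:E.
have B0 k w : (0 <= B k w)%E by rewrite lee_fin (lyap_between_ge0 adm).
have mB k : measurable_fun [set: Omega] (B k) by exact: (measurable_between adm).
have Ag : (\int[P]_w (A%:E * (g w)%:E) <= (lyap f xs S 0 y0)%:E)%E.
  apply: le_trans (expected_lyap_between_sum adm tau_indep tau_law y0 t0).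
  rewrite -integral_nneseries//; last by move=> k w _; exact: B0.
  apply: ae_ge0_le_integral => //.
  - by move=> w _; rewrite mule_ge0 ?lee_fin ?(ltW A0).
  - exact: measurable_funeM.
  - by move=> w _; apply: nneseries_ge0 => k _ _; exact: B0.
  - by apply: ge0_emeasurable_sum => [k w _ _|k _]; [exact: B0|exact: mB].
  - apply: filterS (good_outcome_ae tau_indep tau_law) => w gw _.
    have [x0 cx cz pw] := path gw.
    (* The index depends on the outcome; bounding one nonnegative term by the whole series avoids a
       measurable choice of it. *)
    have [k Ak] := path_lyap adm gw start cx cz pw t0 x0.
    apply: (@le_trans _ _ (B k w)); first by rewrite -EFinM lee_fin.
    apply: (le_trans _ (nneseries_lim_ge k.+1 (fun i _ _ => B0 i w))).
    by rewrite big_nat_recr//= leeDr// sume_ge0// => i _; exact: B0.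
have Eg : (\int[P]_w (g w)%:E <= (lyap f xs S 0 y0 / A)%:E)%E.
  move: Ag; rewrite ge0_integralZl_EFin//; last 2 first.
  - by move=> w _; rewrite lee_fin.
  - exact: ltW.
  by rewrite mulrC EFinM -lee_pdivlMl.
have gint : P.-integrable [set: Omega] (fun w => (g w)%:E).
  apply/integrableP; split => //.
  under eq_integral do rewrite /= ger0_norm//.
  exact: (le_lt_trans Eg (ltry _)).
have -> : ('E_P[fun w => f (x w t)] = \int[P]_w (g w)%:E + (f xs)%:E)%E.
  rewrite unlock.
  have -> : (\int[P]_w (f (x w t))%:E = \int[P]_w ((g w)%:E + (f xs)%:E))%E.
    by apply: eq_integral => w _; rewrite -EFinD subrK.
  rewrite integralD//; last exact: finite_measure_integrable_cst.
  by rewrite integral_cst//= probability_setT mule1.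
by rewrite addeK.
Qed.

End expected_objective.

(** * The two schemes *)

Section convex_scheme.
Context {R : realType} {d : nat}.
Variables (f : 'rV[R]_d -> R) (xs : 'rV[R]_d) (L : R).
Hypotheses (L0 : 0 < L) (cf : convex_fun f) (df : forall x, differentiable f x)
  (sf : L_smooth f L) (minf : forall y, f xs <= f y).

(** Since z is constant along the flow, u^2 (x - z) is constant too, whence the gap ratio (s / u)^2.
    The weight t^2 / (4 L) has derivative t / (2 L), which equals both (2 / t) times the weight and
    the step of z. *)
Definition convex_scheme : scheme R :=
  {| eta_x := fun t => 2 / t; eta_z := fun _ => 0; step_z := fun t => t / (2 * L);
     mix_x := fun s u => 1 - (s / u) ^+ 2; mix_z := fun _ _ => 0;
     wt_f := fun t => t ^+ 2 / (4 * L); wt_z := fun _ => 1 / 2;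
     dwt_f := fun t => t / (2 * L); dwt_z := fun _ => 0;
     drift_x := fun t => t / (2 * L); drift_z := fun _ => 0 |}.

Lemma measurable_inv : measurable_fun [set: R] (fun x : R => x^-1).
Proof.
(* Squaring gives the power a nonnegative base, and the factor x restores the sign and the
   convention that the inverse of 0 is 0. *)
have -> : (fun x : R => x^-1) = (fun x => x * (x ^+ 2) `^ (-1)).
  apply/funext => x; rewrite powR_inv1 ?sqr_ge0//.
  have [->|x0] := eqVneq x 0; first by rewrite invr0 mul0r.
  by rewrite expr2 invfM mulrA mulfV// mul1r.
apply: measurable_funM => //.
apply: (measurableT_comp (measurable_powR (-1))).
exact: measurable_funX.
Qed.

(** With c = t / (2 L), the terms in c <grad f x, z - xs> cancel. What remains is c times the
    convexity inequality at xs ([h2]) and the descent inequality weighted by L c^2, which absorbs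
    c^2 |grad f x|^2 / 2 ([h1]). *)
Lemma convex_scheme_generator t (y : 'rV[R]_d * 'rV[R]_d) : 0 <= t ->
  generator f xs convex_scheme t y +
  (lyap f xs convex_scheme t (gstep f L convex_scheme t y) -
   lyap f xs convex_scheme t y) <= 0.
Proof.
case: y => x z t0; rewrite /generator /lyap /gstep /=.
have := smooth_descent x L0 sf; have := convex_grad_le xs cf (df x).
move: (f (x - L^-1 *: grad f x)) => f'; move: (grad f x) => g; set c := t / (2 * L).
have -> : z - c *: g - xs = (z - xs) - c *: g by rewrite addrAC.
have -> : z - x = (z - xs) + (xs - x) by rewrite addrA subrK.
move: (z - xs) (xs - x) => v u.
rewrite /sqnorm !dotvE (dotvC v g) => hc hs.
have tL : t ^+ 2 / (4 * L) = L * c ^+ 2 by rewrite /c; field; rewrite gt_eqF.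
have c0 : 0 <= c by rewrite divr_ge0// mulr_ge0// ltW.
have h1 : L * c ^+ 2 * (f' - f x) <= - (c ^+ 2 * dotv g g / 2).
  have -> : - (c ^+ 2 * dotv g g / 2) = L * c ^+ 2 * (- ((2 * L)^-1 * dotv g g)).
    by field; rewrite gt_eqF.
  apply: ler_wpM2l; first by rewrite mulr_ge0 ?sqr_ge0 ?(ltW L0).
  by rewrite lerBlDr addrC.
have h2 : c * (f x - f xs + dotv g u) <= 0 by rewrite mulr_ge0_le0//; lra.
by rewrite tL; lra.
Qed.

Lemma convex_scheme_admissible : admissible f xs L convex_scheme.
Proof.
have cid (k : R) : continuous (fun t : R => t / k).
  by move=> t; apply: cvgM; [exact: cvg_id|exact: cvg_cst].
have L2 : 2 * L != 0 by rewrite mulf_neq0 ?gt_eqF.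
split => //=.
- by move=> t t0; rewrite divr_ge0 ?sqr_ge0// mulr_ge0// ltW.
- move=> t.
  have -> : (fun t : R => t ^+ 2 / (4 * L)) = (4 * L)^-1 \*: (@id R ^+ 2).
    by apply/funext => u; rewrite mulrC.
  apply: is_derive_eq; rewrite -[LHS]/((4 * L)^-1 * ((2%:R * t ^+ 1) * 1)).
  by field; rewrite gt_eqF.
- by move=> t; exact: is_derive_cst.
- by split => // t; exact: cvg_cst.
- by move=> t t0; field; rewrite !gt_eqF.
- by move=> t _; rewrite mulr0.
- by move=> t t0; rewrite divr_ge0// ltW.
- move=> s u s0 su; have u0 : 0 < u by exact: le_lt_trans su.
  have un0 : u != 0 by rewrite gt_eqF.
  have dV := @is_deriveV _ id u 1 1 un0 (is_derive_id u 1).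
  have -> : (fun u : R => 1 - (s / u) ^+ 2) = cst 1 - (s \*: (fun v : R => (id v)^-1)) ^+ 2.
    by apply/funext => v.
  apply: is_derive_eq.
  rewrite -[LHS]/(0 - (2%:R * (s * u^-1) ^+ 1) * (s * (- u ^- 2 * 1))).
  by field.
- by move=> s u s0 su; rewrite mul0r; exact: is_derive_cst.
- move=> s u s0 su; split; last exact: cvg_cst.
  move: s0; rewrite le_eqVlt => /predU1P[<-|s0].
    have -> : (fun u0 : R => 1 - (0 / u0) ^+ 2) = cst 1.
      by apply/funext => v; rewrite mul0r expr0n subr0.
    exact: cvg_cst.
  have u0 : u != 0 by rewrite gt_eqF// (lt_le_trans s0).
  apply: cvgB; first exact: cvg_cst.
  have c : s / v @[v --> u] --> s / u.
    by apply: cvgM; [exact: cvg_cst|apply: cvgV => //; exact: cvg_id].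
  rewrite [X in _ --> X]expr2; under eq_fun do rewrite expr2.
  exact: cvgM.
- move=> s; rewrite le_eqVlt => /predU1P[<-|s0].
    by right; rewrite expr0n mul0r.
  by left; rewrite divff ?gt_eqF// expr1n subrr.
- split; last exact: measurable_cst.
  apply: measurable_funB => //; apply: measurable_funX; apply: measurable_funM => //.
  by apply: (measurableT_comp measurable_inv).
- exact: convex_scheme_generator.
Qed.

End convex_scheme.

Section strongly_convex_scheme.
Context {R : realType} {d : nat}.
Variables (f : 'rV[R]_d -> R) (xs : 'rV[R]_d) (L mu : R).
Hypotheses (L0 : 0 < L) (cf : convex_fun f) (df : forall x, differentiable f x)
  (sf : L_smooth f L) (minf : forall y, f xs <= f y).
Hypotheses (mu0 : 0 < mu) (scf : strongly_convex f mu).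

Local Notation rate := (Num.sqrt (mu / L)).

(** With equal rates the two points approach each other symmetrically: their gap decays at twice the
    rate, and each covers half of what is lost. *)
Definition strongly_convex_scheme : scheme R :=
  {| eta_x := fun _ => rate; eta_z := fun _ => rate;
     step_z := fun _ => (Num.sqrt (mu * L))^-1;
     mix_x := fun s u => (1 - expR (- (2 * rate * (u - s)))) / 2;
     mix_z := fun s u => (1 - expR (- (2 * rate * (u - s)))) / 2;
     wt_f := fun t => expR (rate * t); wt_z := fun t => mu / 2 * expR (rate * t);
     dwt_f := fun t => rate * expR (rate * t);
     dwt_z := fun t => mu / 2 * (rate * expR (rate * t));
     drift_x := fun t => rate * expR (rate * t);
     drift_z := fun t => mu / 2 * (rate * expR (rate * t)) |}.

Lemma rateE : rate = mu / Num.sqrt (mu * L).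
Proof.
have muL0 : 0 < mu * L by exact: mulr_gt0.
have r0 : 0 < Num.sqrt (mu * L) by rewrite sqrtr_gt0.
have -> : mu / L = (mu / Num.sqrt (mu * L)) ^+ 2.
  by rewrite expr_div_n sqr_sqrtr ?(ltW muL0)//; field; rewrite !gt_eqF.
by rewrite sqrtr_sqr ger0_norm// divr_ge0// ltW.
Qed.

(** With v = z - xs and u = xs - x, the distance terms of the drift add up to a multiple of |u|^2 -
    |v + u|^2. Strong convexity at xs supplies the missing - |u|^2 ([h3]), the square is discarded
    ([h2]), and descent pays for the jump ([h1]). *)
Lemma strongly_convex_scheme_generator t (y : 'rV[R]_d * 'rV[R]_d) : 0 <= t ->
  generator f xs strongly_convex_scheme t y +
  (lyap f xs strongly_convex_scheme t (gstep f L strongly_convex_scheme t y) -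
   lyap f xs strongly_convex_scheme t y) <= 0.
Proof.
case: y => x z t0; rewrite /generator /lyap /gstep /=.
have := smooth_descent x L0 sf; have := scf x xs.
move: (f (x - L^-1 *: grad f x)) => f'; move: (grad f x) => g.
have E0 := expR_gt0 (rate * t); move: (expR _) E0 => E E0.
have muL0 : 0 < mu * L by exact: mulr_gt0.
have r0 : 0 < Num.sqrt (mu * L) by rewrite sqrtr_gt0.
have rE : mu * (Num.sqrt (mu * L))^-1 = rate by rewrite rateE.
have cE : mu / 2 * (Num.sqrt (mu * L))^-1 ^+ 2 = (2 * L)^-1.
  by rewrite exprVn sqr_sqrtr ?(ltW muL0)//; field; rewrite !gt_eqF.
have rate0 : 0 <= rate by rewrite sqrtr_ge0.
move: (Num.sqrt (mu * L))^-1 rate cE rE rate0 => c r cE rE rate0.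
have -> : z - c *: g - xs = (z - xs) - c *: g by rewrite addrAC.
have -> : z - x = (z - xs) + (xs - x) by rewrite addrA subrK.
have -> : x - z = - (z - xs) - (xs - x) by rewrite !opprB [RHS]addrC addrA subrK.
move: (z - xs) (xs - x) => v u.
have := sqnorm_ge0 (v + u).
rewrite /sqnorm !dotvE (dotvC v g) (dotvC u v) => hn hc hs.
have h1 : E * (f' - f x) <= - (E * ((2 * L)^-1 * dotv g g)).
  rewrite -mulrN; apply: ler_wpM2l; first exact: ltW.
  by rewrite lerBlDr addrC.
have h2 : 0 <= E * r * (mu / 2) * (dotv v v + dotv v u + (dotv v u + dotv u u)).
  by rewrite !mulr_ge0// ?(ltW E0)// ltW.
have h3 : E * r * (f x - f xs + dotv g u + mu / 2 * dotv u u) <= 0.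
  by rewrite mulr_ge0_le0// ?mulr_ge0// ?(ltW E0)//; lra.
rewrite -cE in h1.
rewrite -rE in h2 h3 *.
by lra.
Qed.

Lemma strongly_convex_scheme_admissible : admissible f xs L strongly_convex_scheme.
Proof.
have r0 : 0 <= rate by exact: sqrtr_ge0.
have dE (t : R) : is_derive t 1 (fun t : R => expR (rate * t)) (rate * expR (rate * t)).
  have dl : is_derive t 1 (fun t : R => rate * t) rate.
    have -> : (fun t : R => rate * t) = rate \*: (@id R) by [].
    by apply: is_derive_eq; rewrite -[LHS]/(rate * 1) mulr1.
  rewrite [rate * expR _]mulrC.
  exact: (@is_derive1_comp _ (@expR R) (fun t : R => rate * t) t _ _ (is_derive_expR _) dl).
have cE : continuous (fun t : R => expR (rate * t)).
  move=> t; apply: differentiable_continuous; apply/derivable1_diffP.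
  by case: (dE t).
have crE : continuous (fun t : R => rate * expR (rate * t)).
  by move=> t; apply: cvgM; [exact: cvg_cst|exact: cE].
have cmE : continuous (fun t : R => mu / 2 * (rate * expR (rate * t))).
  by move=> t; apply: cvgM; [exact: cvg_cst|exact: crE].
have mix (s u : R) : is_derive u 1 (fun u : R => (1 - expR (- (2 * rate * (u - s)))) / 2)
    (rate * expR (- (2 * rate * (u - s)))).
  have dl : is_derive u 1 (fun u : R => - (2 * rate * (u - s))) (- (2 * rate)).
    have -> : (fun u : R => - (2 * rate * (u - s))) = - ((2 * rate) \*: (@id R - cst s)) by [].
    by apply: is_derive_eq; rewrite subr0 -[LHS]/(- (2 * rate * 1)) mulr1.
  have dc := @is_derive1_comp _ (@expR R) (fun u : R => - (2 * rate * (u - s))) u _ _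
    (is_derive_expR _) dl.
  have -> : (fun u : R => (1 - expR (- (2 * rate * (u - s)))) / 2) =
      2^-1 \*: (cst 1 - (@expR R \o (fun u : R => - (2 * rate * (u - s))))).
    by apply/funext => v; rewrite mulrC.
  apply: is_derive_eq; rewrite -[LHS]/(2^-1 * (0 - expR (- (2 * rate * (u - s))) * - (2 * rate))).
  by field.
have mixE (s u : R) : rate * expR (- (2 * rate * (u - s))) =
    rate * (1 - (1 - expR (- (2 * rate * (u - s)))) / 2 -
                (1 - expR (- (2 * rate * (u - s)))) / 2) by field.
have mix_cont (s u : R) : {for u, continuous (fun u : R => (1 - expR (- (2 * rate * (u - s)))) / 2)}.
  apply: differentiable_continuous; apply/derivable1_diffP.
  by case: (mix s u).
have mix_meas : measurable_fun [set: R * R]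
    (fun p : R * R => (1 - expR (- (2 * rate * (p.2 - p.1)))) / 2).
  apply: measurable_funM => //; apply: measurable_funB => //.
  apply: measurableT_comp => //; apply: measurableT_comp => //.
  by apply: measurable_funM => //; exact: measurable_funB.
split => //=.
- by move=> t _; rewrite mulr_ge0 ?expR_ge0// divr_ge0// ltW.
- move=> t; have dEt := dE t.
  have -> : (fun t : R => mu / 2 * expR (rate * t)) = (mu / 2) \*: (fun t : R => expR (rate * t)) by [].
  exact: is_derive_eq.
- by split => // t; exact: cvg_cst.
- by move=> t _; rewrite mulrC.
- by move=> t _; rewrite [in RHS]mulrAC mulrA.
- by move=> s u _ _; rewrite -mixE.
- by move=> s u _ _; rewrite -mixE.
- by move=> s _; left; rewrite subrr mulr0 oppr0 expR0 subrr mul0r.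
- by move=> s _; rewrite subrr mulr0 oppr0 expR0 subrr mul0r.
- exact: strongly_convex_scheme_generator.
Qed.

End strongly_convex_scheme.

(* The ODE is singular at time [0]: it forces [t ^ 2 (x - z)] to be constant, and
   a finite limit of [x] at [0] makes this constant vanish. *)
Lemma singular_start {R : realType} {d : nat} (e : R) (x z : R -> 'rV[R]_d)
  (l z0 : 'rV[R]_d) : 0 < e ->
  (forall t, 0 < t -> t < e -> is_derive t 1 x ((2 / t) *: (z t - x t)) /\
    is_derive t 1 z (0 *: (x t - z t))) ->
  x r @[r --> 0^'+] --> l -> z r @[r --> 0^'+] --> z0 -> l = z0.
Proof.
move=> e0 ode cx cz; apply/rowP => i.
have cxi : x r 0 i @[r --> 0^'+] --> l 0 i by exact: cvg_coord.
have czi : z r 0 i @[r --> 0^'+] --> z0 0 i by exact: cvg_coord.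
have zE t : 0 < t < e -> z t 0 i = z0 0 i.
  apply: (@eq_right_limit _ (fun r => z r 0 i) 0 e) => // u /andP[u0 ue].
  have [_ /is_derive_coord dz] := ode _ u0 ue.
  by have := dz i; rewrite scale0r mxE.
have cid : r @[r --> 0^'+] --> (0 : R) by apply: cvg_at_right_filter; exact: cvg_id.
have xE t : 0 < t < e -> x t 0 i = z0 0 i.
  move=> te; have /andP[t0 _] := te.
  have : t * t * (x t 0 i - z0 0 i) = 0.
    apply: (@eq_right_limit _ (fun r => r * r * (x r 0 i - z0 0 i)) 0 e) => //.
      move=> u /andP[u0 ue]; have [/is_derive_coord dx _] := ode _ u0 ue.
      have dxi := dx i.
      have -> : (fun r => r * r * (x r 0 i - z0 0 i)) =
          (@id R * @id R) * ((fun r => x r 0 i) - cst (z0 0 i)) by [].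
      apply: is_derive_eq; rewrite !mxE zE ?u0//.
      rewrite -[LHS]/(u * u * (2 / u * (z0 0 i - x u 0 i) - 0) +
        (x u 0 i - z0 0 i) * (u * 1 + u * 1)).
      by field; rewrite gt_eqF.
    suff : r * r * (x r 0 i - z0 0 i) @[r --> 0^'+] --> 0 * 0 * (l 0 i - z0 0 i).
      by rewrite !mul0r.
    apply: cvgM; first exact: cvgM.
    by apply: cvgB => //; exact: cvg_cst.
  by move/eqP; rewrite !mulf_eq0 (gt_eqF t0)/= subr_eq0 => /eqP.
have cxz : x r 0 i @[r --> 0^'+] --> z0 0 i.
  apply: cvg_near_cst; near=> r.
  by rewrite xE//; apply/andP; split; near: r; [exact: nbhs_right_gt|exact: nbhs_right_lt].
exact: norm_cvg_unique cxi cxz.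
Unshelve. all: by end_near. Qed.

Theorem theorem3 (R : realType) (d : nat) (f : 'rV[R]_d -> R) (L : R)
  (xs x0 z0 : 'rV[R]_d)
  (dT : measure_display) (Omega : measurableType dT) (P : probability Omega R)
  (tau : nat -> {RV P >-> R}) :
  0 < L ->
  convex_fun f ->
  (forall x, differentiable f x) ->
  L_smooth f L ->
  (forall y, f xs <= f y) ->
  mutual_indep P tau ->
  (forall k (A : set R), measurable A ->
     distribution P (tau k) A = exponential_prob (1 : R) A) ->
  (* Part 1 *)
  (forall x z : Omega -> R -> 'rV[R]_d,
     (forall t, measurable_fun [set: Omega] (fun w => f (x w t))) ->
     (forall w, good_outcome tau w ->
        [/\ x w 0 = x0, z w 0 = z0,
            z w r @[r --> 0^'+] --> z0,
            (exists l : 'rV[R]_d, x w r @[r --> 0^'+] --> l) &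
            continuized_path f (fun t => 2 / t) (fun _ => 0)
              (fun _ => L^-1) (fun t => t / (2 * L))
              (fun k => jump_time tau k w) (x w) (z w)]) ->
     forall t, 0 < t ->
       ('E_P[fun w => f (x w t)] - (f xs)%:E
          <= (2 * L * sqnorm (z0 - xs) / t ^+ 2)%:E)%E)
  /\
  (* Part 2 *)
  (forall mu, 0 < mu -> strongly_convex f mu ->
   forall x z : Omega -> R -> 'rV[R]_d,
     (forall t, measurable_fun [set: Omega] (fun w => f (x w t))) ->
     (forall w, good_outcome tau w ->
        [/\ x w 0 = x0, z w 0 = z0,
            x w r @[r --> 0^'+] --> x0,
            z w r @[r --> 0^'+] --> z0 &
            continuized_path f (fun _ => Num.sqrt (mu / L))
              (fun _ => Num.sqrt (mu / L))
              (fun _ => L^-1) (fun _ => (Num.sqrt (mu * L))^-1)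
              (fun k => jump_time tau k w) (x w) (z w)]) ->
     forall t, 0 <= t ->
       ('E_P[fun w => f (x w t)] - (f xs)%:E
          <= ((f x0 - f xs + mu / 2 * sqnorm (z0 - xs))
                * expR (- (Num.sqrt (mu / L) * t)))%:E)%E).
Proof.
move=> L0 cf df sf minf tau_indep tau_law; split.
  move=> x z mf path t t0.
  have adm := convex_scheme_admissible L0 cf df sf minf.
  have A0 : 0 < wt_f (convex_scheme L) t by rewrite /= divr_gt0 ?exprn_gt0// mulr_gt0.
  (* The construction starts at [(z0, z0)]: the right limit of x at 0 is forced to be [z0], while
     the value [x0] at time 0 itself has weight zero. *)
  have start : flow (convex_scheme L) 0 0 (z0, z0) = (z0, z0).
    by rewrite /flow /= !subrr !scaler0 !addr0.
  apply: (@le_trans _ _ (lyap f xs (convex_scheme L) 0 (z0, z0) /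
      wt_f (convex_scheme L) t)%:E); last first.
    rewrite lee_fin /lyap /= expr0n !mul0r add0r le_eqVlt; apply/orP; left.
    by apply/eqP; field; rewrite !gt_eqF.
  apply: (@expected_objective _ _ f xs L _ adm _ _ P tau tau_indep tau_law (z0, z0) x z) => //.
    move=> w gw; have [_ _ cz [l cx] pw] := path w gw.
    split => //=; first by left; rewrite expr0n mul0r.
    have [ode _ _] := pw.
    have T0 : jump_time tau 0 w = 0 by rewrite /jump_time big_ord0.
    have e0 : 0 < jump_time tau 1 w by rewrite -T0; exact: jump_time_lt.
    have := ode 0%N; rewrite T0 => ode0.
    by rewrite -(singular_start e0 ode0 cx cz).
  exact: ltW.
move=> mu mu0 scf x z mf path t t0.
have adm := strongly_convex_scheme_admissible L0 cf df sf minf mu0 scf.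
set S := strongly_convex_scheme L mu in adm.
have A0 : 0 < wt_f S t by exact: expR_gt0.
have start : flow S 0 0 (x0, z0) = (x0, z0).
  by rewrite /flow /= subrr mulr0 oppr0 expR0 subrr mul0r !scale0r !addr0.
apply: (@le_trans _ _ (lyap f xs S 0 (x0, z0) / wt_f S t)%:E); last first.
  by rewrite lee_fin /lyap /= mulr0 expR0 mul1r mulr1 -expRN.
apply: (@expected_objective _ _ f xs L _ adm _ _ P tau tau_indep tau_law (x0, z0) x z) => //.
by move=> w gw; have [xw0 _ cx cz pw] := path w gw; split => //=; right.
Qed.
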